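(* Let $b_0(u,z)=1+\sum_{k\ge0}\sum_{N\ge1}|\Omega_{k,0}^N|u^kz^N$ and $b_1(u,z)=\sum_{k\ge0}\sum_{N\ge1}|\Omega_{k,1}^N|u^kz^N$ be the bivariate generating functions of the first two rows of the aromatic bicomplex, let $c_1(z)=\sum_{N\ge1}|\mathcal I_1^N|z^N$, and let $s(z)=\sum_{N\ge1}|\Psi^N|z^N$ be the generating function of the solenoidal aromatic trees. Then, as formal power series, $$b_0(u,z)=a(z)\exp\Big(\sum_{k=1}^\infty\frac{(-1)^{k-1}}{k}u^kt(z^k)\Big),$$ $$b_1(u,z)=b_0(u,z)\frac{t(z)(1+u-u\,t(z))}{(1-t(z))^2},$$ $$c_1(z)=z\,b_1(0,z)=\frac{z\,a(z)t(z)}{(1-t(z))^2},$$ $$s(z)=a(z)t(z)-\mathring a(z).$$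
   Context: Aromatic forests. Let $V$ be a finite nonempty set of nodes and $E\subset V\times V$ a set of edges; an edge $(v,w)$ goes from $v$ to $w$ and then $v$ is a predecessor of $w$; $\Pi(v)$ is the set of predecessors of $v$. Each node is the source of at most one edge; nodes with no outgoing edge are called roots. $V$ is split into vertices $V^\bullet$ and covertices $V^\circ$. The covertices are numbered $1,\dots,p$, the roots are numbered $1,\dots,n$, the vertices are not numbered. Such graphs, up to isomorphism preserving the vertex/covertex type and the numberings, are called aromatic forests; $\mathcal F_{n,p}^N$ is the set of aromatic forests with $n$ roots, $p$ covertices and exactly $N$ nodes. Aromatic forms. $S_n^\bullet$ and $S_p^\circ$ act on $\mathcal F_{n,p}^N$ by permuting the numbers of the roots, respectively covertices. $\wedge^\bullet\gamma=\frac1{n!}\sum_{\sigma\in S_n^\bullet}\varepsilon(\sigma)\sigma\gamma$, $\wedge^\circ\gamma=\frac1{p!}\sum_{\sigma\in S_p^\circ}\varepsilon(\sigma)\sigma\gamma$, $\wedge=\wedge^\bullet\wedge^\circ$, extended linearly. $\Omega_{n,p}^N=\wedge\operatorname{Span}_{\mathbb R}(\mathcal F_{n,p}^N)$. $|X|$ denotes the dimension of a vector space $X$. For $\gamma\in\mathcal F_{1,0}^N$ with root $r$, $d_H\gamma$ is the sum over all nodes $u$ (including $u=r$) of $\gamma$ with the edge $(r,u)$ added; linearly $d_H:\Omega_{1,0}^N\to\Omega_{0,0}^N$. $\Psi^N=\operatorname{Ker}(d_H|_{\Omega_{1,0}^N})$ is the space of solenoidal combinations of aromatic trees of order $N$.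 For $\gamma\in\mathcal F_{0,1}^N$ with covertex $c$, let $I\gamma=(-1)^{|\Pi(c)|}\sum\gamma'$, the sum over all ways of redirecting simultaneously the outgoing edges of all predecessors of $c$ (including $c$ itself if $(c,c)$ is an edge) to nodes different from $c$, independently (one term per map $\Pi(c)\to V\setminus\{c\}$). Extended linearly, $\mathcal I_1^N=I(\Omega_{0,1}^N)$ (the type-1 functional forms). Generating functions. $t(z)=\sum_{N\ge1}T_Nz^N$, where $T_N$ is the number of (unlabelled) rooted trees with $N$ nodes. $a(z)=1+\sum_{N\ge1}|\Omega_{0,0}^N|z^N$ (the $1$ counts the empty scalar). $\mathring a(z)=\sum_{N\ge1}|\mathring\Omega_0^N|z^N$, where $\mathring\Omega_0^N\subset\Omega_{0,0}^N$ is the span of the forests in $\mathcal F_{0,0}^N$ with at least one 1-loop (an edge $(v,v)$). *)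

(* Defs.v *)
From HB Require Import structures.
From mathcomp Require Import all_boot all_order all_fingroup all_algebra.
From mathcomp Require Import generic_quotient boolp reals.

Set Implicit Arguments.
Unset Strict Implicit.
Unset Printing Implicit Defensive.

Import Order.TTheory GRing.Theory Num.Theory.
Local Open Scope ring_scope.
Local Open Scope quotient_scope.

Record fps (A : Type) := Fps { coefs :> nat -> A }.

Lemma fpsP (A : Type) (f g : fps A) : f =1 g -> f = g.
Proof. by case: f g => [f] [g] /= /funext ->. Qed.

HB.instance Definition _ (A : Type) := gen_eqMixin (fps A).
HB.instance Definition _ (A : Type) := gen_choiceMixin (fps A).

Section FpsRing.
Variable A : comNzRingType.
Implicit Types f g h : fps A.

Definition fps_zero : fps A := Fps (fun=> 0).
Definition fps_opp f : fps A := Fps (fun n => - f n).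
Definition fps_add f g : fps A := Fps (fun n => f n + g n).
Definition fpsC (c : A) : fps A := Fps (fun n => if n == 0%N then c else 0).
Definition fps_mul f g : fps A :=
  Fps (fun n => \sum_(i < n.+1) f i * g (n - i)%N).

Fact fps_addA : associative fps_add.
Proof. by move=> f g h; apply: fpsP => n /=; rewrite addrA. Qed.
Fact fps_addC : commutative fps_add.
Proof. by move=> f g; apply: fpsP => n /=; rewrite addrC. Qed.
Fact fps_add0 : left_id fps_zero fps_add.
Proof. by move=> f; apply: fpsP => n /=; rewrite add0r. Qed.
Fact fps_addN : left_inverse fps_zero fps_opp fps_add.
Proof. by move=> f; apply: fpsP => n /=; rewrite addNr. Qed.
HB.instance Definition _ :=
  GRing.isZmodule.Build (fps A) fps_addA fps_addC fps_add0 fps_addN.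

Definition fps_trunc (n : nat) f : {poly A} := \poly_(i < n.+1) f i.

Lemma fps_mul_trunc n m f g : (m <= n)%N ->
  fps_mul f g m = (fps_trunc n f * fps_trunc n g)`_m.
Proof.
move=> le_mn; rewrite coefM; apply: eq_bigr => i _.
have le_in : (i <= n)%N by rewrite (leq_trans _ le_mn) // -ltnS.
by rewrite !coef_poly !ltnS le_in (leq_trans (leq_subr i m) le_mn).
Qed.

Fact fps_mulC : commutative fps_mul.
Proof.
by move=> f g; apply: fpsP => n; rewrite !(@fps_mul_trunc n) // mulrC.
Qed.

Fact fps_mulA : associative fps_mul.
Proof.
have mulAl f g h n :
    fps_mul (fps_mul f g) h n =
    (fps_trunc n f * fps_trunc n g * fps_trunc n h)`_n.
  rewrite coefM /=; apply: eq_bigr => i _.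
  rewrite -[X in X * _]/(fps_mul f g i) (@fps_mul_trunc n) -1?ltnS //.
  by rewrite coef_poly ltnS leq_subr.
move=> f g h; apply: fpsP => n.
by rewrite fps_mulC !mulAl mulrC mulrA.
Qed.

Fact fps_mul1 : left_id (fpsC 1) fps_mul.
Proof.
move=> f; apply: fpsP => n /=; rewrite big_ord_recl /= mul1r subn0.
by rewrite big1 ?addr0 // => i _; rewrite mul0r.
Qed.
Fact fps_mulDl : left_distributive fps_mul fps_add.
Proof.
move=> f g h; apply: fpsP => n /=; rewrite -big_split /=.
by apply: eq_bigr => i _; rewrite mulrDl.
Qed.
Fact fps_1_neq0 : fpsC 1 != fps_zero.
Proof.
apply/eqP => /(congr1 (fun f : fps A => f 0%N)) /= /eqP.
by rewrite oner_eq0.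
Qed.
HB.instance Definition _ :=
  GRing.Zmodule_isComNzRing.Build (fps A)
    fps_mulA fps_mulC fps_mul1 fps_mulDl fps_1_neq0.

(** The inverse is chosen among the inverses, when there is one. *)
Definition fps_unit : {pred fps A} := fun f => `[< exists g, g * f = 1 >].

Definition fps_inv f : fps A :=
  if pselect (exists g, g * f = 1) is left fV then projT1 (cid fV) else f.

Fact fps_mulVx : {in fps_unit, left_inverse 1 fps_inv *%R}.
Proof.
move=> f /asboolP fV; rewrite /fps_inv.
by case: pselect => // fV'; case: (cid fV').
Qed.
Fact fps_unitPl f g : g * f = 1 -> fps_unit f.
Proof. by move=> gf1; apply/asboolP; exists g. Qed.
Fact fps_inv_out : {in [predC fps_unit], fps_inv =1 id}.
Proof.
move=> f /asboolPn fV; rewrite /fps_inv.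
by case: pselect.
Qed.
HB.instance Definition _ :=
  GRing.ComNzRing_hasMulInverse.Build (fps A)
    fps_mulVx fps_unitPl fps_inv_out.

Definition fpsX : fps A := Fps (fun n => (n == 1%N)%:R).

(** The infinite sum [\sum_(k >= m) F k], for a family such that [F k] is a
    multiple of the [k]-th power of the variable: the terms of index [k > n]
    do not contribute to the coefficient of degree [n]. *)
Definition fps_sum (m : nat) (F : nat -> fps A) : fps A :=
  Fps (fun n => \sum_(m <= k < n.+1) F k n).

(** [f(z^k)], meant for [k > 0]. *)
Definition fps_substX (k : nat) f : fps A :=
  Fps (fun n => if (k %| n)%N then f (n %/ k)%N else 0).

(** Meant for [f] without constant term. *)
Definition fps_exp f : fps A := fps_sum 0 (fun m => f ^+ m / m`!%:R).

(** [\sum_(N >= 1) d N z^N]; the coefficient ring is left arbitrary so that the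
    series can be read both in [Q[[z]]] and in [Q[[u]][[z]]]. *)
Definition gf (d : nat -> nat) : fps A :=
  Fps (fun N => if N == 0%N then 0 else (d N)%:R).

End FpsRing.
Arguments fpsX {A}.
Arguments gf A d : clear implicits.

(** Bivariate series are elements of [Q[[u]][[z]]]: [b N k] is the coefficient
    of [u^k z^N] in [b]. *)
Notation bifps := (fps (fps rat)).

Definition bi_u : bifps := fpsC fpsX.

(** [\sum_(k >= 0) \sum_(N >= 1) d k N u^k z^N] *)
Definition bigf (d : nat -> nat -> nat) : bifps :=
  Fps (fun N => Fps (fun k => if N == 0%N then 0 else (d k N)%:R)).

Definition bi_u0 (b : bifps) : fps rat := Fps (fun N => b N 0%N).

(** Graphs on the node set ['I_N]. As a node is the source of at most one edge,
    the edge set is given by a map [out]: [out v = Some w] when [(v, w)] is an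
    edge, and [out v = None] when [v] is a root. The numberings of the roots
    and of the covertices start from [0]; the vertices are the nodes outside
    the image of [covertex]. *)
Definition graph_data (n p N : nat) : Type :=
  {ffun 'I_N -> option 'I_N} * {ffun 'I_n -> 'I_N} * {ffun 'I_p -> 'I_N}.

Definition graph_axiom (n p N : nat) (d : graph_data n p N) : bool :=
  [&& injectiveb d.1.2,
      [forall v, (d.1.1 v == None) == (v \in codom d.1.2)]
    & injectiveb d.2].

Record graph (n p N : nat) := Graph {
  graph_val : graph_data n p N;
  _ : graph_axiom graph_val
}.

HB.instance Definition _ n p N := [isSub for @graph_val n p N].
HB.instance Definition _ n p N := [Finite of graph n p N by <:].

Section Graph.
Variables (n p N : nat).
Implicit Types g h : graph n p N.

Definition out g : {ffun 'I_N -> option 'I_N} := (graph_val g).1.1.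
Definition root g : {ffun 'I_n -> 'I_N} := (graph_val g).1.2.
Definition covertex g : {ffun 'I_p -> 'I_N} := (graph_val g).2.

Definition edge g : rel 'I_N := fun v w => out g v == Some w.
Definition predecessors g (v : 'I_N) : {set 'I_N} := [set w | edge g w v].

Definition graph_iso : rel (graph n p N) := fun g h =>
  [exists s : {perm 'I_N},
    [&& [forall v, out h (s v) == omap s (out g v)],
        [forall i, root h i == s (root g i)]
      & [forall j, covertex h j == s (covertex g j)]]].

Fact graph_iso_refl : reflexive graph_iso.
Proof.
move=> g; apply/existsP; exists 1%g; apply/and3P; split; apply/forallP => x.
- by rewrite perm1; case: (out g x) => [w|] //=; rewrite perm1.
- by rewrite perm1.
- by rewrite perm1.
Qed.

Fact graph_iso_trans : transitive graph_iso.
Proof.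
move=> h g k /existsP[s /and3P[/forallP so /forallP sr /forallP sc]].
move=> /existsP[t /and3P[/forallP to /forallP tr /forallP tc]].
apply/existsP; exists (s * t)%g; apply/and3P; split; apply/forallP => x.
- rewrite permM (eqP (to _)) (eqP (so _)).
  by case: (out g x) => [w|] //=; rewrite permM.
- by rewrite permM (eqP (tr _)) (eqP (sr _)).
- by rewrite permM (eqP (tc _)) (eqP (sc _)).
Qed.

Fact graph_iso_sym : symmetric graph_iso.
Proof.
suff sym g h : graph_iso g h -> graph_iso h g.
  by move=> g h; apply/idP/idP; apply: sym.
move=> /existsP[s /and3P[/forallP so /forallP sr /forallP sc]].
apply/existsP; exists s^-1%g; apply/and3P; split; apply/forallP => x.
- rewrite -{2}(permKV s x) (eqP (so _)).
  by case: (out g _) => [w|] //=; rewrite permK.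
- by rewrite (eqP (sr _)) permK.
- by rewrite (eqP (sc _)) permK.
Qed.

Canonical graph_iso_equiv :=
  EquivRel graph_iso graph_iso_refl graph_iso_sym graph_iso_trans.

Definition forest := {eq_quot graph_iso_equiv}.

HB.instance Definition _ := EqQuotient.on forest.
HB.instance Definition _ := Countable.copy forest (can_type (@reprK _ forest)).
HB.instance Definition _ : isFinite forest := CanIsFinite (@reprK _ forest).
End Graph.

(** Operations on aromatic forests are defined on representatives
    ([repr] picks a graph in the class, [\pi] is the class of a graph); they do
    not depend on the chosen representative. *)

Fact permute_roots_subproof n p N (s : 'S_n) (g : graph n p N) :
  graph_axiom (out g, [ffun i => root g (s^-1%g i)], covertex g).
Proof.
case: g => -[[o r] c] /= g_ax; rewrite /out /root /covertex /=.
case/and3P: g_ax => /= /injectiveP r_inj /forallP r_codom c_inj.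
apply/and3P; split=> //=.
- by apply/injectiveP => i j; rewrite !ffunE => /r_inj /perm_inj.
- apply/forallP => v; rewrite (eqP (r_codom v)); apply/eqP.
  apply/codomP/codomP => -[i ->].
    by exists (s i); rewrite ffunE permK.
  by exists (s^-1%g i); rewrite ffunE.
Qed.

(** The root numbered [i] in [g] gets the number [s i]. *)
Definition permute_roots n p N (s : 'S_n) (g : graph n p N) : graph n p N :=
  Graph (permute_roots_subproof s g).

Fact permute_covertices_subproof n p N (s : 'S_p) (g : graph n p N) :
  graph_axiom (out g, root g, [ffun i => covertex g (s^-1%g i)]).
Proof.
case: g => -[[o r] c] /= g_ax; rewrite /out /root /covertex /=.
case/and3P: g_ax => /= r_inj r_codom /injectiveP c_inj.
apply/and3P; split=> //=.
by apply/injectiveP => i j; rewrite !ffunE => /c_inj /perm_inj.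
Qed.

Definition permute_covertices n p N (s : 'S_p) (g : graph n p N) :
    graph n p N :=
  Graph (permute_covertices_subproof s g).

Fact add_root_edge_subproof N (g : graph 1 0 N) (u : 'I_N) :
  graph_axiom ([ffun v => if v == root g ord0 then Some u else out g v],
               [ffun _ : 'I_0 => u], covertex g).
Proof.
case: g => -[[o r] c] /= g_ax; rewrite /out /root /covertex /=.
case/and3P: g_ax => /= _ /forallP r_codom c_inj.
apply/and3P; split=> //=; first by apply/injectiveP => -[].
apply/forallP => v; rewrite ffunE; apply/eqP.
have -> : (v \in codom [ffun _ : 'I_0 => u]) = false.
  by apply/negbTE/codomP => -[[]].
have [_ //|v_neq] := eqVneq v (r ord0); rewrite (eqP (r_codom v)).
by apply/negbTE/codomP => -[i]; rewrite ord1 => /eqP; rewrite (negPf v_neq).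
Qed.

Definition add_root_edge N (g : graph 1 0 N) (u : 'I_N) : graph 0 0 N :=
  Graph (add_root_edge_subproof g u).

Fact redirect_subproof N (g : graph 0 1 N) (f : {ffun 'I_N -> 'I_N}) :
  graph_axiom ([ffun v => if v \in predecessors g (covertex g ord0)
                          then Some (f v) else out g v],
               root g, covertex g).
Proof.
case: g => -[[o r] c] /= g_ax.
rewrite /predecessors /edge /out /root /covertex /=.
case/and3P: g_ax => /= r_inj /forallP r_codom c_inj.
apply/and3P; split=> //=; apply/forallP => v; rewrite ffunE inE.
case: ifP => [/eqP ov|_]; last exact: r_codom.
by rewrite -(eqP (r_codom v)) ov.
Qed.

Definition redirect N (g : graph 0 1 N) (f : {ffun 'I_N -> 'I_N}) :
    graph 0 1 N :=
  Graph (redirect_subproof g f).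

Definition forest_space (R : realType) (n p N : nat) : vectType R :=
  {ffun forest n p N -> R^o}.

Definition basis_vec (R : realType) n p N (x : forest n p N) :
    forest_space R n p N :=
  [ffun y => (y == x)%:R].

Section LinearExtension.
Variables (R : realType) (n p N : nat) (W : vectType R).
Variable f : forest n p N -> W.

Definition lin_ext_fun (w : forest_space R n p N) : W :=
  \sum_x (w : {ffun _ -> R^o}) x *: f x.

Fact lin_ext_is_linear : linear lin_ext_fun.
Proof.
move=> a v w; rewrite /lin_ext_fun scaler_sumr -big_split /=.
by apply: eq_bigr => x _; rewrite !ffunE scalerDl scalerA.
Qed.
HB.instance Definition _ :=
  GRing.isLinear.Build R (forest_space R n p N) W *:%R lin_ext_fun
    lin_ext_is_linear.

Definition lin_ext : 'Hom(forest_space R n p N, W) := linfun lin_ext_fun.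
End LinearExtension.

Definition wedge_roots (R : realType) (n p N : nat) :
    'End(forest_space R n p N) :=
  lin_ext (fun x : forest n p N =>
    (n`!%:R : R)^-1 *: \sum_(s : 'S_n)
      (-1) ^+ s *: basis_vec R (\pi_(forest n p N) (permute_roots s (repr x)))).

Definition wedge_covertices (R : realType) (n p N : nat) :
    'End(forest_space R n p N) :=
  lin_ext (fun x : forest n p N =>
    (p`!%:R : R)^-1 *: \sum_(s : 'S_p)
      (-1) ^+ s *:
        basis_vec R (\pi_(forest n p N) (permute_covertices s (repr x)))).

Definition wedge (R : realType) (n p N : nat) : 'End(forest_space R n p N) :=
  (wedge_roots R n p N \o wedge_covertices R n p N)%VF.

Definition Omega (R : realType) (n p N : nat) :
    {vspace forest_space R n p N} :=
  limg (wedge R n p N).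

Definition dH (R : realType) (N : nat) :
    'Hom(forest_space R 1 0 N, forest_space R 0 0 N) :=
  lin_ext (fun x : forest 1 0 N =>
    \sum_(u : 'I_N)
      basis_vec R (\pi_(forest 0 0 N) (add_root_edge (repr x) u))).

Definition Psi (R : realType) (N : nat) : {vspace forest_space R 1 0 N} :=
  (lker (dH R N) :&: Omega R 1 0 N)%VS.

(** The sum runs over the maps [Pi(c) -> V \ {c}], each one being extended to
    all of [V] by the value [c] outside [Pi(c)]; [redirect] does not depend on
    this extension. *)
Definition functional_sum (R : realType) (N : nat) (x : forest 0 1 N) :
    forest_space R 0 1 N :=
  let g := repr x in
  let c := covertex g ord0 in
  (-1) ^+ #|predecessors g c| *:
    \sum_(f : {ffun 'I_N -> 'I_N} |
            f \in pffun_on c (predecessors g c) (predC1 c))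
      basis_vec R (\pi_(forest 0 1 N) (redirect g f)).

Definition I_op (R : realType) (N : nat) : 'End(forest_space R 0 1 N) :=
  lin_ext (@functional_sum R N).

Definition I1 (R : realType) (N : nat) : {vspace forest_space R 0 1 N} :=
  (I_op R N @: Omega R 0 1 N)%VS.

Definition has_1loop n p N (g : graph n p N) : bool :=
  [exists v, edge g v v].

Definition Omega_circ (R : realType) (N : nat) :
    {vspace forest_space R 0 0 N} :=
  <<[seq basis_vec R x |
       x <- enum [set y : forest 0 0 N | has_1loop (repr y)]]>>%VS.

(** A rooted tree is a graph without covertices, with a single root, to which
    every node is connected by a directed path. *)
Definition is_rooted_tree N (g : graph 1 0 N) : bool :=
  [forall v, connect (edge g) v (root g ord0)].

Definition num_rooted_trees (N : nat) : nat :=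
  #|[set x : forest 1 0 N | is_rooted_tree (repr x)]|.

Definition t_gf (A : comNzRingType) : fps A := gf A num_rooted_trees.

Definition a_gf (R : realType) (A : comNzRingType) : fps A :=
  1 + gf A (fun N => \dim (Omega R 0 0 N)).

Definition a_circ_gf (R : realType) (A : comNzRingType) : fps A :=
  gf A (fun N => \dim (Omega_circ R N)).

Definition b0_gf (R : realType) : bifps :=
  1 + bigf (fun k N => \dim (Omega R k 0 N)).

Definition b1_gf (R : realType) : bifps :=
  bigf (fun k N => \dim (Omega R k 1 N)).

Definition c1_gf (R : realType) : fps rat := gf rat (fun N => \dim (I1 R N)).

Definition s_gf (R : realType) : fps rat := gf rat (fun N => \dim (Psi R N)).

(* Main.v *)
Require Import Defs.
From HB Require Import structures.
From mathcomp Require Import all_boot all_order all_fingroup all_algebra.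
From mathcomp Require Import generic_quotient boolp reals.
From mathcomp Require Import zify ring.

Set Implicit Arguments.
Unset Strict Implicit.
Unset Printing Implicit Defensive.

Import Order.TTheory GRing.Theory Num.Theory.

(** The theorem is a count of isomorphism classes of functional graphs.

    _Dimensions are numbers of classes._  A forest is, up to the numbers of its
    roots, a finite structure: a partial self-map of the nodes ([None] at the
    roots) together with some marked nodes (the covertex, if any).  The space
    [Omega R n p N], for [p <= 1], has one dimension for each orbit of the
    permutations of the roots whose stabilizers contain no odd permutation.  If
    an automorphism moves a root, then the trees above this root and above its
    image are isomorphic, and exchanging these two trees is an automorphism
    acting on the roots by a transposition.  So the dimension is the number of
    classes of structures with [n] roots which are rigid, in the sense that all
    their automorphisms fix all roots ([dim_Omega]).

    _Products of series._  All products come from one bijection: a structure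
    in which a root is marked is the disjoint union of the tree above this root
    and of the rest, and isomorphisms respect this splitting
    ([num_classes_peel]).

    - [b0]: a rigid structure without marks is a structure without roots and a
      set of pairwise distinct trees.  Allowing one more tree of size [m]
      multiplies the series by [1 + u z^m] ([num_classes_forest_add]), and the
      product of these factors is the exponential of the statement, because
      both satisfy the same first order differential equation in [z]
      ([fps_exp_polya_log]).
    - [b1]: the covertex [c] is a root, which contributes [u t b0]; otherwise
      its outgoing edge is cut, and the target of this edge is marked.  If the
      target is outside the tree above [c], this leaves a tree and a structure
      with one mark: [t b1].  If it is in this tree, [c] was on a cycle, and
      this leaves a tree with a marked node, and a structure without marks:
      [q b0], where the series [q] of the pointed trees satisfies
      [q = t + t q] by the same cutting.  Solving
      [b1 = u t b0 + q b0 + t b1] gives the formula.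
    - [c1]: the operator [I] takes its values in the span of the forests whose
      covertex has no predecessor, and fixes these forests.  Cutting the edge
      of such a covertex leaves an isolated node and a forest with [N - 1]
      nodes and one mark.
    - [s]: the forests with one root are counted by [a t], being a tree and a
      forest without roots, and [Psi] is the kernel of [dH].  The rank of [dH]
      is the number of forests with a 1-loop ([dim_limg_dH]): let [unloop]
      replace a forest by the sum of all redirections of all its 1-loops to
      other nodes, with a sign given by the parity of their number.  It vanishes
      on the image of [dH] and fixes the forests without 1-loop, so the rank is
      at most this number.  Conversely, the term of [dH] in which the root
      becomes a 1-loop is the only one with the maximal number of 1-loops; hence
      every forest is, modulo the image of [dH], a combination of forests
      without 1-loop. *)

(** * Numbers of equivalence classes *)

Section CountingClasses.

Definition equivalence_prop (X : Type) (E : X -> X -> Prop) :=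
  [/\ forall x, E x x, forall x y, E x y -> E y x
    & forall x y z, E x y -> E y z -> E x z].

Definition class_of (X : finType) (E : X -> X -> Prop) x : {set X} :=
  [set y | `[< E x y >]].

Definition nclasses (X : finType) (E : X -> X -> Prop) (P : X -> Prop) : nat :=
  #|[set class_of E x | x in [set x | `[< P x >]]]|.

Lemma class_ofP (X : finType) (E : X -> X -> Prop) x y :
  equivalence_prop E -> class_of E x = class_of E y <-> E x y.
Proof.
move=> [Er Es Et]; split=> [/setP/(_ y)|Exy].
  by rewrite !inE => eqxy; apply/asboolP; rewrite eqxy; apply/asboolP.
apply/setP => z; rewrite !inE; apply/asboolP/asboolP; first exact/Et/Es.
exact: Et.
Qed.

Lemma nclasses_le (X Y : finType) (E : X -> X -> Prop) (F : Y -> Y -> Prop)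
    (P : X -> Prop) (Q : Y -> Prop) (R : X -> Y -> Prop) :
    equivalence_prop E -> equivalence_prop F ->
    (forall y, Q y -> exists2 x, P x & R x y) ->
    (forall x y x' y', P x -> P x' -> Q y -> Q y' -> R x y -> R x' y' ->
       E x x' -> F y y') ->
  (nclasses F Q <= nclasses E P)%N.
Proof.
move=> eqE eqF surR RE; have [Er Es Et] := eqE; have [Fr Fs Ft] := eqF.
pose w (C : {set X}) : {set Y} :=
  [set y' | `[< exists x y, [/\ x \in C, P x, Q y, R x y & F y y'] >]].
apply: leq_trans (leq_imset_card w _); apply: subset_leq_card.
apply/subsetP => _ /imsetP[y /[!inE] /asboolP Qy ->].
have [x Px Rxy] := surR _ Qy.
apply/imsetP; exists (class_of E x).
  by apply/imsetP; exists x; rewrite // inE; apply/asboolP.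
apply/setP => y'; rewrite !inE; apply/asboolP/asboolP => [Fyy'|].
  by exists x, y; split=> //; rewrite inE; apply/asboolP.
move=> [x0 [y0 [/[!inE]/asboolP Exx0 Px0 Qy0 Rx0y0 Fy0y']]].
exact: Ft (RE _ _ _ _ Px Px0 Qy Qy0 Rxy Rx0y0 Exx0) Fy0y'.
Qed.

(** Being total on both sides makes the induced map between the classes well
    defined everywhere and surjective, and the compatibility makes it
    injective. The correspondence need not be a function, which avoids choosing
    representatives when the nodes of two structures are glued or split. *)
Lemma nclasses_corr (X Y : finType) (E : X -> X -> Prop) (F : Y -> Y -> Prop)
    (P : X -> Prop) (Q : Y -> Prop) (R : X -> Y -> Prop) :
    equivalence_prop E -> equivalence_prop F ->
    (forall x, P x -> exists2 y, Q y & R x y) ->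
    (forall y, Q y -> exists2 x, P x & R x y) ->
    (forall x y x' y', P x -> P x' -> Q y -> Q y' -> R x y -> R x' y' ->
       E x x' <-> F y y') ->
  nclasses E P = nclasses F Q.
Proof.
move=> eqE eqF RX RY REF; apply/eqP; rewrite eqn_leq; apply/andP; split.
  apply: (nclasses_le (R := fun y x => R x y)) => // y x y' x' Qy Qy' Px Px'.
  by move=> Rxy Rxy' Fyy'; apply/(REF x y x' y').
apply: (nclasses_le (R := R)) => // x y x' y' Px Px' Qy Qy' Rxy Rxy' Exx'.
by apply/(REF x y x' y').
Qed.

Lemma eq_nclasses (X : finType) (E : X -> X -> Prop) (P Q : X -> Prop) :
  (forall x, P x <-> Q x) -> nclasses E P = nclasses E Q.
Proof. by move=> PQ; congr nclasses; apply/funext => x; apply/propext. Qed.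

Lemma nclasses_split (X : finType) (E : X -> X -> Prop) (P D : X -> Prop) :
    equivalence_prop E -> (forall x y, E x y -> D x -> D y) ->
  nclasses E P = (nclasses E (fun x => P x /\ D x)
                  + nclasses E (fun x => P x /\ ~ D x))%N.
Proof.
move=> eqE invD; have [Er Es Et] := eqE; rewrite /nclasses.
rewrite (_ : [set x | `[< P x >]] =
    [set x | `[< P x /\ D x >]] :|: [set x | `[< P x /\ ~ D x >]]); last first.
  apply/setP => x; rewrite !inE; apply/asboolP/orP => [Px|].
    by have [Dx|nDx] := pselect (D x); [left|right]; apply/asboolP.
  by case=> /asboolP[].
rewrite imsetU cardsU -[X in _ - X](_ : 0 = _)%N ?subn0 //.
apply/esym/eqP; rewrite cards_eq0; apply/eqP/setP => C; rewrite in_set0.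
apply/negP; rewrite inE => /andP[/imsetP[x /[!inE]/asboolP[_ Dx] ->]].
move=> /imsetP[y /[!inE]/asboolP[_ nDy]] /(class_ofP _ _ eqE) Exy.
exact/nDy/(invD x).
Qed.

Lemma nclasses0 (X : finType) (E : X -> X -> Prop) (P : X -> Prop) :
  (forall x, ~ P x) -> nclasses E P = 0%N.
Proof.
move=> nP; rewrite /nclasses (_ : [set x | `[< P x >]] = set0) ?imset0 ?cards0 //.
by apply/setP => x; rewrite !inE; apply/asboolP => /nP.
Qed.

(** Sorting the classes by an invariant size turns the splittings of a
    structure in two parts into convolutions. *)
Lemma nclasses_size (X : finType) (E : X -> X -> Prop) (P : X -> Prop)
    (s : X -> nat) n :
    equivalence_prop E -> (forall x y, E x y -> s x = s y) ->
    (forall x, P x -> s x < n)%N ->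
  nclasses E P = (\sum_(i < n) nclasses E (fun x => P x /\ s x = i))%N.
Proof.
move=> eqE invs lt_sn.
rewrite -(eq_nclasses E (P := fun x => P x /\ s x < n)%N); last first.
  by move=> x; split=> [[]//|Px]; split; last exact: lt_sn.
elim: n {lt_sn} => [|n IH]; first by rewrite big_ord0 nclasses0 // => x [].
rewrite big_ord_recr /= -IH.
rewrite (nclasses_split _ (D := fun x => s x < n)%N) //; last first.
  by move=> x y /invs ->.
congr addn; apply: eq_nclasses => x.
  by split=> [[[? ?] ?]|[? ?]] //; split=> //; split=> //; lia.
by split=> [[[? ?] ?]|[? sx]]; split=> //; [lia|split=> //; lia|lia].
Qed.

Lemma nclasses_prod (X Y : finType) (E : X -> X -> Prop) (F : Y -> Y -> Prop)
    (P : X -> Prop) (Q : Y -> Prop) :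
    equivalence_prop E -> equivalence_prop F ->
  nclasses (fun z z' : X * Y => E z.1 z'.1 /\ F z.2 z'.2)
           (fun z => P z.1 /\ Q z.2) = (nclasses E P * nclasses F Q)%N.
Proof.
move=> [Er _ _] [Fr _ _]; rewrite /nclasses -cardsX.
set CX := imset (class_of E) _; set CY := imset (class_of F) _.
have inCX C : C \in CX -> exists x, x \in C.
  by case/imsetP => x _ ->; exists x; rewrite inE; apply/asboolP.
have inCY C : C \in CY -> exists y, y \in C.
  by case/imsetP => y _ ->; exists y; rewrite inE; apply/asboolP.
rewrite -(card_in_imset (f := fun CD : {set X} * {set Y} => setX CD.1 CD.2)).
  congr #|pred_of_set _|; apply/setP => C; apply/imsetP/imsetP.
    move=> [[x y] /[!inE]/asboolP[/= Px Qy] ->].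
    exists (class_of E x, class_of F y) => /=.
      rewrite in_setX /=; apply/andP; split; apply/imsetP.
        by exists x; rewrite // inE; apply/asboolP.
      by exists y; rewrite // inE; apply/asboolP.
    apply/setP => -[x' y']; rewrite in_setX !inE /=.
    by apply/asboolP/andP => [[? ?]|[/asboolP ? /asboolP ?]]; split=> //;
       apply/asboolP.
  move=> [[C1 D1]]; rewrite in_setX /= => /andP[].
  move=> /imsetP[x /[!inE]/asboolP Px ->] /imsetP[y /[!inE]/asboolP Qy ->] ->.
  exists (x, y); first by rewrite inE; apply/asboolP.
  apply/setP => -[x' y']; rewrite in_setX !inE /=.
  by apply/andP/asboolP => [[/asboolP ? /asboolP ?]|[? ?]]; split=> //;
     apply/asboolP.
move=> [C D] [C' D']; rewrite !in_setX /= => /andP[C1 D1] /andP[C2 D2] eqCD.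
have [[x xC] [y yD]] := (inCX _ C1, inCY _ D1).
have : (x, y) \in setX C' D' by rewrite -eqCD in_setX xC.
rewrite in_setX => /andP[xC' yD']; congr (_, _); apply/setP => z.
  by have /setP/(_ (z, y)) := eqCD; rewrite !in_setX /= yD yD' !andbT.
by have /setP/(_ (x, z)) := eqCD; rewrite !in_setX /= xC xC'.
Qed.

Lemma equivalence_prop_prod (X Y : Type) (E : X -> X -> Prop)
    (F : Y -> Y -> Prop) :
    equivalence_prop E -> equivalence_prop F ->
  equivalence_prop (fun z z' : X * Y => E z.1 z'.1 /\ F z.2 z'.2).
Proof.
move=> [Er Es Et] [Fr Fs Ft]; split=> [z|z z' [? ?]|z z' z'' [E1 F1] [E2 F2]].
- by split.
- by split; [apply: Es|apply: Fs].
- by split; [apply: Et E1 E2|apply: Ft F1 F2].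
Qed.

(** Used to enumerate the trees of a given size one by one. *)
Lemma nclasses_reps (X : finType) (E : X -> X -> Prop) (P : X -> Prop) :
    equivalence_prop E ->
  exists l : seq X, [/\ size l = nclasses E P, forall x, x \in l -> P x,
    forall x, P x -> exists2 y, y \in l & E x y
    & pairwise (fun x y => ~~ `[< E x y >]) l].
Proof.
move=> eqE; have [Er Es Et] := eqE.
pose CC := [set class_of E x | x in [set x | `[< P x >]]].
have repP C : C \in CC -> exists x, P x /\ C = class_of E x.
  by case/imsetP => x /[!inE]/asboolP Px ->; exists x.
have [/eqP|nz] := eqVneq #|CC| 0%N.
  rewrite cards_eq0 => /eqP CC0; exists [::]; split=> //.
    by rewrite /nclasses -/CC CC0 cards0.
  move=> x Px; have : class_of E x \in CC by apply/imset_f; rewrite inE; apply/asboolP.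
  by rewrite CC0 inE.
have [x0 _] : exists x0 : X, true.
  by have /card_gt0P[C /repP[x _]] : (0 < #|CC|)%N by [rewrite lt0n]; exists x.
have /choice[rep repE] : forall C, exists x, C \in CC -> P x /\ C = class_of E x.
  move=> C; have [/repP[x Cx]|_] := boolP (C \in CC); last by exists x0.
  by exists x.
exists [seq rep C | C <- enum CC]; split.
- by rewrite size_map -cardE.
- by move=> _ /mapP[C /[!mem_enum] /repE[PC _] ->].
- move=> x Px; have Cx : class_of E x \in CC by apply/imset_f; rewrite inE; apply/asboolP.
  exists (rep (class_of E x)); first by apply: map_f; rewrite mem_enum.
  by apply/(class_ofP _ _ eqE); have [] := repE _ Cx.
- rewrite pairwise_map; have := enum_uniq CC; rewrite uniq_pairwise.
  apply: sub_in_pairwise (allss _) => C D; rewrite !mem_enum /= => CC1 CC2.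
  apply: contra_neqN => /asboolP ECD; have [_ ->] := repE _ CC1.
  by have [_ ->] := repE _ CC2; apply/(class_ofP _ _ eqE).
Qed.

End CountingClasses.

(** * Functional graphs with marked nodes *)

Section Structures.

Definition struct (K V : finType) : Type :=
  ({ffun V -> option V} * {ffun K -> V})%type.
HB.instance Definition _ K V := Finite.on (struct K V).

Definition isomap (K V W : finType) (x : struct K V) (y : struct K W)
    (f : V -> W) :=
  [/\ bijective f, forall v, y.1 (f v) = omap f (x.1 v)
    & forall k, f (x.2 k) = y.2 k].

Definition iso (K V W : finType) (x : struct K V) (y : struct K W) :=
  exists f, isomap x y f.

Lemma isomap_id (K V : finType) (x : struct K V) : isomap x x id.
Proof.
by split=> //; [exists id|move=> v; case: (x.1 v)].
Qed.

Lemma isomap_inv (K V W : finType) (x : struct K V) (y : struct K W) f :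
  isomap x y f -> exists g, [/\ isomap y x g, cancel f g & cancel g f].
Proof.
move=> [[g fK gK] fo fm]; exists g; split=> //; split; first by exists f.
  by move=> v; rewrite -{2}(gK v) fo; case: (x.1 (g v)) => //= w; rewrite fK.
by move=> k; rewrite -fm fK.
Qed.

Lemma isomap_comp (K V W U : finType) (x : struct K V) (y : struct K W)
    (z : struct K U) f g :
  isomap x y f -> isomap y z g -> isomap x z (g \o f).
Proof.
move=> [bf fo fm] [bg go gm]; split; first exact: bij_comp.
  by move=> v /=; rewrite go fo; case: (x.1 v).
by move=> k /=; rewrite fm gm.
Qed.

Lemma iso_refl (K V : finType) (x : struct K V) : iso x x.
Proof. by exists id; apply: isomap_id. Qed.

Lemma iso_sym (K V W : finType) (x : struct K V) (y : struct K W) :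
  iso x y -> iso y x.
Proof. by move=> [f /isomap_inv[g [? _ _]]]; exists g. Qed.

Lemma iso_trans (K V W U : finType) (x : struct K V) (y : struct K W)
    (z : struct K U) :
  iso x y -> iso y z -> iso x z.
Proof.
by move=> [f f_iso] [g g_iso]; exists (g \o f); apply: isomap_comp g_iso.
Qed.

Lemma iso_equivalence (K V : finType) : equivalence_prop (@iso K V V).
Proof.
by split; [exact: iso_refl|exact: iso_sym|move=> x y z; apply: iso_trans].
Qed.

Lemma iso_card (K V W : finType) (x : struct K V) (y : struct K W) :
  iso x y -> #|V| = #|W|.
Proof. by move=> [f [/bij_eq_card]]. Qed.

Definition transport (K V W : finType) (f : V -> W) (g : W -> V)
    (x : struct K V) : struct K W :=
  ([ffun w => omap f (x.1 (g w))], [ffun k => f (x.2 k)]).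

Lemma isomap_transport (K V W : finType) (f : V -> W) (g : W -> V)
    (x : struct K V) :
  cancel f g -> cancel g f -> isomap x (transport f g x) f.
Proof.
by move=> fK gK; split; [by exists g|move=> v|move=> k]; rewrite /= ffunE ?fK.
Qed.

(** The classes are counted on the nodes ['I_N]; this transfers structures
    built on other types of nodes. *)
Lemma iso_ord (K V : finType) (x : struct K V) n :
  #|V| = n -> exists y : struct K 'I_n, iso x y.
Proof.
move=> <-; exists (transport enum_rank enum_val x), enum_rank.
exact: isomap_transport enum_rankK enum_valK.
Qed.

(** Properties are stated for all finite types of nodes at once, because the
    parts of a structure live on sum types and subtypes. *)
Definition struct_prop (K : finType) := forall V : finType, struct K V -> Prop.

Definition invariant (K : finType) (Q : struct_prop K) :=
  forall V W (x : struct K V) (y : struct K W), iso x y -> Q V x -> Q W y.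

Definition num_classes (K : finType) (Q : struct_prop K) (N : nat) : nat :=
  nclasses (@iso K 'I_N 'I_N) (Q 'I_N).

Lemma eq_num_classes (K : finType) (Q Q' : struct_prop K) N :
  (forall V (x : struct K V), Q V x <-> Q' V x) -> num_classes Q N = num_classes Q' N.
Proof. by move=> QQ'; apply: eq_nclasses => x; apply: QQ'. Qed.

Lemma num_classes_split (K : finType) (Q D : struct_prop K) N : invariant D ->
  num_classes Q N = (num_classes (fun V x => Q V x /\ D V x) N
             + num_classes (fun V x => Q V x /\ ~ D V x) N)%N.
Proof.
move=> invD; apply: nclasses_split; first exact: iso_equivalence.
by move=> x y; apply: invD.
Qed.

Lemma num_classes0 (K : finType) (Q : struct_prop K) N :
  (forall V (x : struct K V), #|V| = N -> ~ Q V x) -> num_classes Q N = 0%N.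
Proof.
by move=> nQ; apply: nclasses0 => x; apply: nQ; rewrite card_ord.
Qed.

(** The construction [F] keeps the nodes, so that the sizes agree on both
    sides. *)
Lemma num_classes_map (K K' : finType) (Q : struct_prop K) (Q' : struct_prop K')
    (F : forall V : finType, struct K V -> struct K' V) N :
    (forall V x, Q V x -> Q' V (F V x)) ->
    (forall V y, Q' V y -> exists2 x, Q V x & F V x = y) ->
    (forall V W (x : struct K V) (y : struct K W), Q V x -> Q W y ->
       iso x y <-> iso (F V x) (F W y)) ->
  num_classes Q N = num_classes Q' N.
Proof.
move=> QF QF' Fiso.
apply: (nclasses_corr (R := fun x y => F _ x = y)).
- exact: iso_equivalence.
- exact: iso_equivalence.
- by move=> x Qx; exists (F _ x) => //; apply: QF.
- by move=> y /QF'.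
- by move=> x _ x' _ Qx Qx' _ _ <- <-; apply: Fiso.
Qed.

(** * Nodes leading to a root *)

Definition arrow (K V : finType) (x : struct K V) : rel V :=
  fun v w => x.1 v == Some w.

Definition reach (K V : finType) (x : struct K V) : rel V := connect (arrow x).

Lemma reach0 (K V : finType) (x : struct K V) v : reach x v v.
Proof. exact: connect0. Qed.

Lemma reach_step (K V : finType) (x : struct K V) u v w :
  x.1 u = Some v -> reach x v w -> reach x u w.
Proof. by move=> uv; apply: connect_trans; apply/connect1/eqP. Qed.

Lemma reach_ind (K V : finType) (x : struct K V) (P : V -> Prop) r :
    P r -> (forall u v, x.1 u = Some v -> reach x v r -> P v -> P u) ->
  forall v, reach x v r -> P v.
Proof.
move=> Pr IH v /connectP[p]; elim: p v => [|w p IHp] v /=; first by move=> _ <-.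
move=> /andP[/eqP vw pw] def_r; apply: (IH v w vw); last exact: IHp pw def_r.
by apply/connectP; exists p.
Qed.

Lemma reachE (K V : finType) (x : struct K V) v r : reach x v r ->
  v = r \/ exists2 w, x.1 v = Some w & reach x w r.
Proof.
by move=> vr; elim/reach_ind: v / vr => [|u v uv vr _]; [left|right; exists v].
Qed.

(** As every node has at most one outgoing edge, the set of the nodes leading
    to a root is stable under the edges in both directions, which is why it can
    be split off. *)
Lemma reach_next (K V : finType) (x : struct K V) v w r :
  x.1 r = None -> x.1 v = Some w -> reach x v r = reach x w r.
Proof.
move=> rN vw; apply/idP/idP; last exact: reach_step.
by case/reachE => [def_v|[w']]; [rewrite def_v rN in vw|rewrite vw => -[<-]].
Qed.

Lemma reach_root (K V : finType) (x : struct K V) r v :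
  x.1 r = None -> reach x r v -> v = r.
Proof. by move=> rN /reachE[//|[w]]; rewrite rN. Qed.

(** Hence the trees above different roots are disjoint. *)
Lemma reach_fun (K V : finType) (x : struct K V) v r s :
  x.1 r = None -> x.1 s = None -> reach x v r -> reach x v s -> r = s.
Proof.
move=> rN sN vr; elim/reach_ind: v / vr => [|u v uv _ IH].
  by move=> /(reach_root rN).
by rewrite (reach_next sN uv).
Qed.

Lemma isomap_reach (K V W : finType) (x : struct K V) (y : struct K W) f v w :
  isomap x y f -> reach y (f v) (f w) = reach x v w.
Proof.
have reach_f (V1 W1 : finType) (x1 : struct K V1) (y1 : struct K W1) f1 v1 w1 :
    isomap x1 y1 f1 -> reach x1 v1 w1 -> reach y1 (f1 v1) (f1 w1).
  move=> [_ fo _] vw; elim/reach_ind: v1 / vw => [|u u' uu' _ IH].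
    exact: reach0.
  by apply: reach_step IH; rewrite fo uu'.
move=> f_iso; apply/idP/idP; last exact: reach_f.
have [g [g_iso fK gK]] := isomap_inv f_iso.
by move=> /(reach_f _ _ _ _ _ _ _ g_iso); rewrite !fK.
Qed.

Lemma isomap_root (K V W : finType) (x : struct K V) (y : struct K W) f v :
  isomap x y f -> y.1 (f v) = None <-> x.1 v = None.
Proof. by move=> [_ -> _]; case: (x.1 v). Qed.

Definition rooted (K : finType) (k : K) (V : finType) (x : struct K V) :=
  x.1 (x.2 k) = None /\ forall v, reach x v (x.2 k).

Lemma rooted_inv (K : finType) (k : K) : invariant (rooted k).
Proof.
move=> V W x y [f f_iso] [rN rr]; have [[g fK gK] fo fm] := f_iso.
split; first by rewrite -fm; apply/(isomap_root _ f_iso).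
by move=> v; rewrite -(gK v) -fm (isomap_reach _ _ f_iso).
Qed.

(** A root leads only to itself, hence a tree has only one root. *)
Lemma rooted_root (K : finType) (k : K) (V : finType) (x : struct K V) v :
  rooted k x -> x.1 v = None <-> v = x.2 k.
Proof.
move=> [rN rr]; split=> [vN|-> //].
by apply: reach_fun vN rN _ (rr v); apply: reach0.
Qed.

(** * Disjoint unions *)

Definition is_inl (A B : Type) (z : A + B) := if z is inl _ then true else false.

Section Union.
Variables (K K1 K2 : finType) (kappa : K -> K1 + K2) (kappa' : K1 + K2 -> K).
Hypotheses (kappaK : cancel kappa kappa') (kappa'K : cancel kappa' kappa).

(** The map [kappa] tells on which side each mark goes. *)
Definition union (V1 V2 : finType) (x1 : struct K1 V1) (x2 : struct K2 V2) :
    struct K (V1 + V2)%type :=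
  ([ffun v => match v with
              | inl a => omap inl (x1.1 a)
              | inr b => omap inr (x2.1 b)
              end],
   [ffun k => match kappa k with
              | inl k1 => inl (x1.2 k1)
              | inr k2 => inr (x2.2 k2)
              end]).

Definition sum_map (A A' B B' : Type) (f : A -> A') (g : B -> B')
    (z : A + B) : A' + B' :=
  match z with inl a => inl (f a) | inr b => inr (g b) end.

Lemma union_out (V1 V2 : finType) (x1 : struct K1 V1) (x2 : struct K2 V2) z :
  (union x1 x2).1 z = match z with
    | inl a => omap inl (x1.1 a) | inr b => omap inr (x2.1 b) end.
Proof. by rewrite /= ffunE. Qed.

Lemma union_mark (V1 V2 : finType) (x1 : struct K1 V1) (x2 : struct K2 V2) k :
  (union x1 x2).2 k = match kappa k with
    | inl k1 => inl (x1.2 k1) | inr k2 => inr (x2.2 k2) end.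
Proof. by rewrite /= ffunE. Qed.

Lemma sum_map_bij (A A' B B' : Type) (f : A -> A') (g : B -> B') :
  bijective f -> bijective g -> bijective (sum_map f g).
Proof.
move=> [f' fK f'K] [g' gK g'K]; exists (sum_map f' g').
  by case=> [a|b] /=; rewrite ?fK ?gK.
by case=> [a|b] /=; rewrite ?f'K ?g'K.
Qed.

Lemma isomap_union (V1 V2 W1 W2 : finType) (x1 : struct K1 V1)
    (x2 : struct K2 V2) (y1 : struct K1 W1) (y2 : struct K2 W2) f1 f2 :
  isomap x1 y1 f1 -> isomap x2 y2 f2 ->
  isomap (union x1 x2) (union y1 y2) (sum_map f1 f2).
Proof.
move=> [b1 o1 m1] [b2 o2 m2]; split; first exact: sum_map_bij.
  case=> [a|b]; rewrite !union_out /= ?o1 ?o2.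
    by case: (x1.1 a).
  by case: (x2.1 b).
by move=> k; rewrite !union_mark; case: (kappa k) => k' /=; rewrite ?m1 ?m2.
Qed.

Lemma iso_union (V1 V2 W1 W2 : finType) (x1 : struct K1 V1)
    (x2 : struct K2 V2) (y1 : struct K1 W1) (y2 : struct K2 W2) :
  iso x1 y1 -> iso x2 y2 -> iso (union x1 x2) (union y1 y2).
Proof. by move=> [f1 i1] [f2 i2]; exists (sum_map f1 f2); apply: isomap_union. Qed.

Lemma reach_union_inl (V1 V2 : finType) (x1 : struct K1 V1)
    (x2 : struct K2 V2) v w :
  reach (union x1 x2) (inl v) (inl w) = reach x1 v w.
Proof.
apply/idP/idP => [|vw]; last first.
  elim/reach_ind: v / vw => [|u v uv _ IH]; first exact: reach0.
  by apply: reach_step IH; rewrite union_out uv.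
suff gen z : reach (union x1 x2) z (inl w) -> forall a, z = inl a -> reach x1 a w.
  by move=> /gen; apply.
move=> zw; elim/reach_ind: z / zw => [|z z' + _ IH] a def_z.
  by case: def_z => <-; apply: reach0.
rewrite def_z union_out; case a_out: (x1.1 a) => [b|] //= -[def_z'].
by apply: reach_step a_out (IH b _).
Qed.

Lemma reach_union_inr (V1 V2 : finType) (x1 : struct K1 V1)
    (x2 : struct K2 V2) v w :
  reach (union x1 x2) (inr v) (inr w) = reach x2 v w.
Proof.
apply/idP/idP => [|vw]; last first.
  elim/reach_ind: v / vw => [|u v uv _ IH]; first exact: reach0.
  by apply: reach_step IH; rewrite union_out uv.
suff gen z : reach (union x1 x2) z (inr w) -> forall a, z = inr a -> reach x2 a w.
  by move=> /gen; apply.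
move=> zw; elim/reach_ind: z / zw => [|z z' + _ IH] a def_z.
  by case: def_z => <-; apply: reach0.
rewrite def_z union_out; case a_out: (x2.1 a) => [b|] //= -[def_z'].
by apply: reach_step a_out (IH b _).
Qed.

(** No edge joins the two sides. *)
Lemma reach_union_side (V1 V2 : finType) (x1 : struct K1 V1)
    (x2 : struct K2 V2) z z' :
  reach (union x1 x2) z z' -> is_inl z = is_inl z'.
Proof.
move=> zz'; elim/reach_ind: z / zz' => // z w + _ <-.
by rewrite union_out; case: z => [a|b]; [case: (x1.1 a)|case: (x2.1 b)] => //= ? [<-].
Qed.

Lemma unionNone (V1 V2 : finType) (x1 : struct K1 V1) (x2 : struct K2 V2) z :
  (union x1 x2).1 z = None <->
  match z with inl a => x1.1 a = None | inr b => x2.1 b = None end.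
Proof. by rewrite union_out; case: z => [a|b]; [case: (x1.1 a)|case: (x2.1 b)]. Qed.

Variable k1 : K1.

(** An isomorphism preserves the marked root, hence the set of the nodes
    leading to it, which is the left side. On both sides it preserves all the
    marks, because [kappa] is onto. *)
Lemma isomap_union_split (V1 V2 W1 W2 : finType) (x1 : struct K1 V1)
    (x2 : struct K2 V2) (y1 : struct K1 W1) (y2 : struct K2 W2) f :
    rooted k1 x1 -> rooted k1 y1 -> isomap (union x1 x2) (union y1 y2) f ->
  exists f1 f2,
    [/\ isomap x1 y1 f1, isomap x2 y2 f2, forall a, f (inl a) = inl (f1 a)
      & forall b, f (inr b) = inr (f2 b)].
Proof.
(* The left side consists of the nodes leading to the marked root. *)
have side (V1' V2' W1' W2' : finType) (z1 : struct K1 V1')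
    (z2 : struct K2 V2') (t1 : struct K1 W1') (t2 : struct K2 W2') h :
    rooted k1 z1 -> isomap (union z1 z2) (union t1 t2) h ->
    forall a, exists a', h (inl a) = inl a'.
  move=> [_ zr] h_iso a.
  have := zr a; rewrite -(@reach_union_inl V1' V2' z1 z2).
  rewrite -(isomap_reach _ _ h_iso) => /reach_union_side.
  have [_ _ /(_ (kappa' (inl k1)))] := h_iso; rewrite !union_mark kappa'K => -> /=.
  by case: (h (inl a)) => // a' _; exists a'.
move=> rx ry f_iso; have [g [g_iso fK gK]] := isomap_inv f_iso.
have /choice[f1 f1E] := side _ _ _ _ _ _ _ _ _ rx f_iso.
have /choice[g1 g1E] := side _ _ _ _ _ _ _ _ _ ry g_iso.
have /choice[f2 f2E] : forall b, exists b', f (inr b) = inr b'.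
  move=> b; case fb: (f (inr b)) => [a|b']; last by exists b'.
  by have := fK (inr b); rewrite fb g1E.
have /choice[g2 g2E] : forall b, exists b', g (inr b) = inr b'.
  move=> b; case gb: (g (inr b)) => [a|b']; last by exists b'.
  by have := gK (inr b); rewrite gb f1E.
have [_ fo fm] := f_iso.
exists f1, f2; split=> //; split.
- exists g1 => a.
    by apply: (@inl_inj _ V2); rewrite -g1E -f1E fK.
  by apply: (@inl_inj _ W2); rewrite -f1E -g1E gK.
- by move=> a; have := fo (inl a); rewrite f1E !union_out; case: (x1.1 a) => [w|];
    case: (y1.1 _) => [w'|] //=; rewrite f1E => -[->].
- move=> k; have := fm (kappa' (inl k)); rewrite !union_mark kappa'K f1E.
  by case.
- exists g2 => b.
    by apply: (@inr_inj V1); rewrite -g2E -f2E fK.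
  by apply: (@inr_inj W1); rewrite -f2E -g2E gK.
- by move=> a; have := fo (inr a); rewrite f2E !union_out; case: (x2.1 a) => [w|];
    case: (y2.1 _) => [w'|] //=; rewrite f2E => -[->].
- move=> k; have := fm (kappa' (inr k)); rewrite !union_mark kappa'K f2E.
  by case.
Qed.

(** No edge leaves a stable set or its complement, so that the restrictions
    lose nothing. *)
Lemma union_of_stable (V : finType) (x : struct K V) (S : pred V) :
    (forall v w, x.1 v = Some w -> S v = S w) ->
    (forall k, S (x.2 k) = is_inl (kappa k)) ->
  exists (x1 : struct K1 {v | S v}) (x2 : struct K2 {v | ~~ S v}),
    isomap (union x1 x2) x
      (fun z => match z with inl a => val a | inr b => val b end).
Proof.
move=> closed marks.
have mark1 k : S (x.2 (kappa' (inl k))) by rewrite marks kappa'K.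
have mark2 k : ~~ S (x.2 (kappa' (inr k))) by rewrite marks kappa'K.
pose x1 : struct K1 {v | S v} :=
  ([ffun v => obind insub (x.1 (val v))], [ffun k => exist (fun v => S v) _ (mark1 k)]).
pose x2 : struct K2 {v | ~~ S v} :=
  ([ffun v => obind insub (x.1 (val v))], [ffun k => exist (fun v => ~~ S v) _ (mark2 k)]).
exists x1, x2; split.
- apply: inj_card_bij; last by rewrite card_sum !card_sig cardC.
  case=> [[a Sa]|[b Sb]] [[a' Sa']|[b' Sb']] /= eq_ab.
  + by congr inl; apply: val_inj.
  + by case/negP: (Sb'); rewrite -eq_ab.
  + by case/negP: (Sb); rewrite eq_ab.
  + by congr inr; apply: val_inj.
- case=> [[a Sa]|[b Sb]]; rewrite union_out /= ffunE /=.
    case out_a: (x.1 a) => [w|] //=; case: insubP => [u _ <- //|].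
    by rewrite -(closed _ _ out_a) Sa.
  case out_b: (x.1 b) => [w|] //=; case: insubP => [u _ <- //|].
  by rewrite -(closed _ _ out_b) Sb.
- move=> k; rewrite union_mark -[in RHS](kappaK k).
  by case: (kappa k) => k' /=; rewrite ffunE.
Qed.

End Union.

End Structures.

(** * Splitting off the tree above a marked root *)

Section Peeling.
Variables (K K1 K2 : finType) (kappa : K -> K1 + K2) (kappa' : K1 + K2 -> K).
Hypotheses (kappaK : cancel kappa kappa') (kappa'K : cancel kappa' kappa).
Variables (k1 : K1).
Let c : K := kappa' (inl k1).

(** The left part is the tree above the marked root [c]. The property [Q]
    forces the marks sent to the left by [kappa] to be exactly those lying in
    this tree; the parts are then determined up to isomorphism by
    [isomap_union_split], and the size of the tree is the summation index. *)
Lemma num_classes_peel (Q : struct_prop K) (Q1 : struct_prop K1) (Q2 : struct_prop K2) N :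
    invariant Q -> invariant Q1 -> invariant Q2 ->
    (forall V (x1 : struct K1 V), Q1 V x1 -> rooted k1 x1) ->
    (forall V (x : struct K V), Q V x ->
       x.1 (x.2 c) = None /\
       forall k, reach x (x.2 k) (x.2 c) = is_inl (kappa k)) ->
    (forall V1 V2 (x1 : struct K1 V1) (x2 : struct K2 V2), rooted k1 x1 ->
       Q _ (union kappa x1 x2) <-> Q1 _ x1 /\ Q2 _ x2) ->
  num_classes Q N = (\sum_(i < N.+1) num_classes Q1 i * num_classes Q2 (N - i))%N.
Proof.
move=> invQ invQ1 invQ2 Q1r Qc Qu.
pose s (V : finType) (x : struct K V) := #|[pred v | reach x v (x.2 c)]|.
have s_iso (V W : finType) (x : struct K V) (y : struct K W) :
    iso x y -> s _ x = s _ y.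
  move=> [f f_iso]; have [[g fK gK] _ fm] := f_iso.
  rewrite /s -!sum1_card [RHS](reindex f) /=; last by exists g => v _.
  by apply: eq_bigl => v; rewrite !inE -fm (isomap_reach _ _ f_iso).
have s_union (V1 V2 : finType) (x1 : struct K1 V1) (x2 : struct K2 V2) :
    rooted k1 x1 -> s _ (union kappa x1 x2) = #|V1|.
  move=> [_ rr]; rewrite -(card_image (@inl_inj V1 V2)); apply: eq_card => z.
  rewrite !inE union_mark kappa'K; apply/idP/imageP => [|[a _ ->]].
    by move=> /reach_union_side; case: z => // a _; exists a.
  by rewrite reach_union_inl rr.
rewrite /num_classes (@nclasses_size _ _ _ (s 'I_N) N.+1) //; first last.
- by move=> x _; rewrite ltnS -[X in (_ <= X)%N](card_ord N) max_card.
- exact: s_iso.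
- exact: iso_equivalence.
apply: eq_bigr => i _.
rewrite -nclasses_prod; try exact: iso_equivalence.
apply: (nclasses_corr (R := fun x z => iso x (union kappa z.1 z.2))).
- exact: iso_equivalence.
- by apply: equivalence_prop_prod; apply: iso_equivalence.
- move=> x [Qx sx]; have [cN marks] := Qc _ _ Qx.
  have closed v w : x.1 v = Some w -> reach x v (x.2 c) = reach x w (x.2 c).
    exact: reach_next.
  have [x1 [x2 u_iso]] := union_of_stable kappaK kappa'K closed marks.
  have r1 : rooted k1 x1.
    have [_ _ /(_ c)] := u_iso; rewrite union_mark kappa'K /= => val_c.
    split=> [|a].
      apply/(unionNone kappa x1 x2 (inl (x1.2 k1)))/(isomap_root _ u_iso).
      by rewrite /= val_c.
    rewrite -(reach_union_inl kappa x1 x2) -(isomap_reach _ _ u_iso).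
    rewrite [X in reach x _ X]val_c; exact: valP a.
  have [y1 iso1] : exists y1 : struct K1 'I_i, iso x1 y1.
    by apply: iso_ord; rewrite card_sig.
  have [y2 iso2] : exists y2 : struct K2 'I_(N - i), iso x2 y2.
    apply: iso_ord; rewrite card_sig -sx.
    have := cardC [pred v | reach x v (x.2 c)]; rewrite card_ord => cardN.
    apply: (@addnI (s _ x)); rewrite subnKC; first exact: cardN.
    by rewrite /s; apply: leq_trans (leq_addr _ _) (eq_leq cardN).
  have x_iso : iso x (union kappa y1 y2).
    apply: iso_trans (iso_union kappa iso1 iso2); apply: iso_sym.
    by eexists; apply: u_iso.
  exists (y1, y2) => //=; apply/Qu; last exact: (invQ _ _ _ _ x_iso).
  exact: rooted_inv iso1 r1.
- move=> [x1 x2] /= [Q1x1 Q2x2]; have r1 := Q1r _ _ Q1x1.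
  have [x x_iso] : exists x : struct K 'I_N, iso (union kappa x1 x2) x.
    by apply: iso_ord; rewrite card_sum !card_ord subnKC // -ltnS.
  exists x; last exact: iso_sym.
  split; first by apply: invQ x_iso _; apply/Qu.
  by rewrite -(s_iso _ _ _ _ x_iso) s_union // card_ord.
- move=> x [x1 x2] y [y1 y2] _ _ /= [/Q1r r1 _] [/Q1r r1' _] x_iso y_iso.
  split=> [xy|[xy1 xy2]]; last first.
    apply: iso_trans x_iso _; apply: iso_trans (iso_sym y_iso).
    exact: iso_union.
  have [f f_iso] : iso (union kappa x1 x2) (union kappa y1 y2).
    by apply: iso_trans (iso_sym x_iso) _; apply: iso_trans y_iso.
  have [f1 [f2 [iso1 iso2 _ _]]] := isomap_union_split kappa'K r1 r1' f_iso.
  by split; [exists f1|exists f2].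
Qed.

End Peeling.

(** * Roots and automorphisms *)

Section RootsAndAutomorphisms.

Definition nroots (K V : finType) (x : struct K V) : nat :=
  #|[set v | x.1 v == None]|.

Definition rigid (K V : finType) (x : struct K V) :=
  forall f, isomap x x f -> forall v, x.1 v = None -> f v = v.

Lemma nroots_iso (K V W : finType) (x : struct K V) (y : struct K W) :
  iso x y -> nroots x = nroots y.
Proof.
move=> [f f_iso]; have [[g fK gK] fo _] := f_iso.
rewrite /nroots -!sum1_card [RHS](reindex f) /=; last by exists g => v _.
by apply: eq_bigl => v; rewrite !inE fo; case: (x.1 v).
Qed.

Lemma rigid_inv (K : finType) : invariant (@rigid K).
Proof.
move=> V W x y [f f_iso] x_rigid h h_iso w wN.
have [g [g_iso fK gK]] := isomap_inv f_iso.
have ghf := isomap_comp (isomap_comp f_iso h_iso) g_iso.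
rewrite -[LHS]gK -[h w]/(h w) -{1}(gK w) -[g _]/((g \o (h \o f)) (g w)).
by rewrite (x_rigid _ ghf) ?gK //; apply/(isomap_root _ g_iso).
Qed.

Definition rigid_roots (K : finType) (k : nat) : struct_prop K :=
  fun V x => nroots x = k /\ rigid x.

Lemma rigid_roots_inv (K : finType) k : invariant (@rigid_roots K k).
Proof.
move=> V W x y xy [xk xr]; split; first by rewrite -(nroots_iso xy).
exact: rigid_inv xy xr.
Qed.

Lemma nroots_rooted (K : finType) (k : K) (V : finType) (x : struct K V) :
  rooted k x -> nroots x = 1%N.
Proof.
move=> xr; rewrite -(cards1 (x.2 k)) /nroots; apply: eq_card => v.
by rewrite !inE; apply/eqP/eqP; move/(rooted_root _ xr).
Qed.

Section UnionRoots.
Variables (K K1 K2 : finType) (kappa : K -> K1 + K2) (kappa' : K1 + K2 -> K).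
Hypotheses (kappa'K : cancel kappa' kappa).
Variables (k1 : K1) (V1 V2 : finType) (x1 : struct K1 V1) (x2 : struct K2 V2).
Hypothesis x1_rooted : rooted k1 x1.

Lemma nroots_union : nroots (union kappa x1 x2) = (nroots x2).+1.
Proof.
rewrite -add1n -(nroots_rooted x1_rooted) /nroots.
rewrite -(card_imset _ (@inl_inj V1 V2)) -(card_imset _ (@inr_inj V1 V2)).
rewrite -cardsUI; set I := (X in (_ + #|pred_of_set X|)%N).
have -> : I = set0.
  apply/setP => z; rewrite !inE; apply/negP => /andP[].
  by move=> /imsetP[a _ ->] /imsetP[].
rewrite cards0 addn0.
apply: eq_card => z; rewrite !inE; apply/eqP/orP => [/unionNone|].
  by case: z => [a|b] vN; [left|right]; apply: imset_f; rewrite inE vN.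
by case=> /imsetP[v /[!inE]/eqP vN ->]; apply/unionNone.
Qed.

(** The root of the left part is marked, so that it is always fixed; only the
    roots of the right part matter. *)
Lemma rigid_union : rigid (union kappa x1 x2) <-> rigid x2.
Proof.
split=> [u_rigid f f_iso v vN|x2_rigid f f_iso z].
  have := u_rigid _ (isomap_union kappa (isomap_id x1) f_iso) (inr v).
  by rewrite unionNone => /(_ vN)[].
have [f1 [f2 [f1_iso f2_iso f1E f2E]]] :=
  isomap_union_split kappa'K x1_rooted x1_rooted f_iso.
move/unionNone; case: z => [a|b] zN.
  rewrite f1E; congr inl; have /(rooted_root _ x1_rooted) -> := zN.
  by apply/(rooted_root _ x1_rooted)/(isomap_root _ f1_iso); case: x1_rooted.
by rewrite f2E x2_rigid.
Qed.

Lemma rigid_roots_union k :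
  rigid_roots k.+1 (union kappa x1 x2) <-> rigid_roots k x2.
Proof.
rewrite /rigid_roots nroots_union rigid_union; split=> -[eqk xr]; split=> //.
  by case: eqk.
by rewrite eqk.
Qed.

End UnionRoots.

(** * Marking a node and cutting an edge *)

Section Marking.
Variables (K K' : finType) (phi : K' -> option K) (phi' : option K -> K').
Hypotheses (phiK : cancel phi phi') (phi'K : cancel phi' phi).

Definition unmark (V : finType) (y : struct K' V) : struct K V :=
  (y.1, [ffun k => y.2 (phi' (Some k))]).

Lemma isomap_unmark (V W : finType) (x : struct K' V) (y : struct K' W) f :
  isomap x y f <-> isomap (unmark x) (unmark y) f /\
                   f (x.2 (phi' None)) = y.2 (phi' None).
Proof.
split=> [[bf fo fm]|[[bf fo fm] fN]].
  by split=> //; split=> // k; rewrite !ffunE fm.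
split=> // k; rewrite -(phiK k); case: (phi k) => [k'|//].
by have := fm k'; rewrite !ffunE.
Qed.

(** A node determined by an invariant property is preserved by the
    isomorphisms, so that marking it neither splits nor merges classes. *)
Lemma num_classes_mark (Q : struct_prop K) (D : forall V : finType, struct K V -> V -> Prop)
    N :
    (forall V W (x : struct K V) (y : struct K W) f v,
       isomap x y f -> D V x v -> D W y (f v)) ->
    (forall V (x : struct K V) v w, Q V x -> D V x v -> D V x w -> v = w) ->
  num_classes (fun V x => Q V x /\ exists v, D V x v) N =
  num_classes (fun V (y : struct K' V) =>
         Q V (unmark y) /\ D V (unmark y) (y.2 (phi' None))) N.
Proof.
move=> invD uniqD.
apply: (nclasses_corr (R := fun x y => x = unmark y)).
- exact: iso_equivalence.
- exact: iso_equivalence.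
- move=> x [Qx [v Dv]].
  pose y : struct K' 'I_N :=
    (x.1, [ffun k => if phi k is Some k' then x.2 k' else v]).
  have xy : x = unmark y.
    rewrite /unmark /y [LHS]surjective_pairing; congr pair; apply/ffunP => k.
    by rewrite !ffunE phi'K.
  by exists y => //; rewrite -xy /= ffunE phi'K.
- by move=> y [Qy Dy]; exists (unmark y) => //; split=> //; eexists; apply: Dy.
- move=> _ x _ y _ _ [Qx Dx] [Qy Dy] -> ->.
  split=> [[f f_iso]|[f /isomap_unmark[f_iso _]]]; last by exists f.
  exists f; apply/isomap_unmark; split=> //.
  exact: (uniqD _ _ _ _ Qy (invD _ _ _ _ _ _ f_iso Dx) Dy).
Qed.

End Marking.

Section Cutting.
Variables (K : finType) (a : K).

(** The target of the removed edge is kept as the mark [None], so that [glue]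
    can put the edge back. *)
Definition cut (V : finType) (x : struct K V) : struct (option K) V :=
  ([ffun v => if v == x.2 a then None else x.1 v],
   [ffun k => if k is Some k' then x.2 k' else odflt (x.2 a) (x.1 (x.2 a))]).

Definition glue (V : finType) (y : struct (option K) V) : struct K V :=
  ([ffun v => if v == y.2 (Some a) then Some (y.2 None) else y.1 v],
   [ffun k => y.2 (Some k)]).

Lemma cut_out (V : finType) (x : struct K V) v :
  (cut x).1 v = if v == x.2 a then None else x.1 v.
Proof. by rewrite /= ffunE. Qed.

Lemma cut_some (V : finType) (x : struct K V) k : (cut x).2 (Some k) = x.2 k.
Proof. by rewrite /= ffunE. Qed.

Lemma cut_none (V : finType) (x : struct K V) :
  (cut x).2 None = odflt (x.2 a) (x.1 (x.2 a)).
Proof. by rewrite /= ffunE. Qed.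

Lemma glueK (V : finType) (y : struct (option K) V) :
  y.1 (y.2 (Some a)) = None -> cut (glue y) = y.
Proof.
move=> yN; rewrite [RHS]surjective_pairing; congr pair; apply/ffunP.
  by move=> v; rewrite !ffunE; case: eqVneq => [->|].
by case=> [k|]; rewrite !ffunE ?eqxx.
Qed.

Lemma cutK (V : finType) (x : struct K V) :
  x.1 (x.2 a) <> None -> glue (cut x) = x.
Proof.
move=> xN; rewrite [RHS]surjective_pairing; congr pair; apply/ffunP.
  move=> v; rewrite !ffunE; case: eqVneq => [->|//].
  by case: (x.1 _) xN.
by move=> k; rewrite !ffunE.
Qed.

Lemma isomap_cut (V W : finType) (x : struct K V) (y : struct K W) f :
  isomap x y f -> isomap (cut x) (cut y) f.
Proof.
move=> [bf fo fm]; have f_inj := bij_inj bf; split=> //.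
  by move=> v; rewrite !cut_out -fm (inj_eq f_inj); case: eqP.
case=> [k|]; rewrite ?cut_some ?cut_none //.
by rewrite -fm fo; case: (x.1 _).
Qed.

Lemma isomap_glue (V W : finType) (x : struct (option K) V)
    (y : struct (option K) W) f :
  isomap x y f -> isomap (glue x) (glue y) f.
Proof.
move=> [bf fo fm]; have f_inj := bij_inj bf; split=> //.
  move=> v; rewrite /= !ffunE -fm (inj_eq f_inj); case: eqP => //=.
  by rewrite fm.
by move=> k; rewrite /= !ffunE fm.
Qed.

(** [cut] and [glue] are inverse to each other and preserve isomorphisms. *)
Lemma num_classes_cut (Q : struct_prop (option K)) N :
  num_classes (fun V x => x.1 (x.2 a) <> None /\ Q V (cut x)) N =
  num_classes (fun V y => y.1 (y.2 (Some a)) = None /\ Q V y) N.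
Proof.
apply: (num_classes_map (F := cut)).
- move=> V x [_ Qx]; split=> //.
  by rewrite cut_some cut_out eqxx.
- move=> V y [yN Qy]; exists (glue y); last exact: glueK.
  by rewrite glueK //; split=> //; rewrite /= !ffunE eqxx.
- move=> V W x y [xN _] [yN _]; split=> [[f]|[f /isomap_glue]].
    by move=> /isomap_cut f_iso; exists f.
  by rewrite !cutK // => f_iso; exists f.
Qed.

Lemma nroots_cut (V : finType) (x : struct K V) :
  x.1 (x.2 a) <> None -> nroots (cut x) = (nroots x).+1.
Proof.
move=> xN; rewrite /nroots -[RHS]add1n.
rewrite (_ : [set v | (cut x).1 v == None] = x.2 a |: [set v | x.1 v == None]).
  by rewrite cardsU1 inE; case: eqP xN.
by apply/setP => v; rewrite !inE cut_out; case: (v == x.2 a).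
Qed.

(** Cutting creates a new root, but this root is marked. *)
Lemma rigid_cut (V : finType) (x : struct K V) :
  x.1 (x.2 a) <> None -> rigid (cut x) <-> rigid x.
Proof.
move=> xN; split=> x_rigid f f_iso v.
  move=> vN; apply: x_rigid; first exact: isomap_cut.
  by rewrite cut_out vN; case: eqP.
rewrite cut_out; case: eqP => [-> _|_ vN].
  by have [_ _ /(_ (Some a))] := f_iso; rewrite cut_some.
apply: x_rigid => //; have := isomap_glue f_iso.
by rewrite cutK.
Qed.

Lemma rigid_roots_cut k (V : finType) (x : struct K V) :
  x.1 (x.2 a) <> None -> rigid_roots k.+1 (cut x) <-> rigid_roots k x.
Proof.
move=> xN; rewrite /rigid_roots nroots_cut // rigid_cut //.
by split=> -[eqk xr]; split=> //; [case: eqk|rewrite eqk].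
Qed.

End Cutting.

End RootsAndAutomorphisms.

(** * Trees above roots *)

Section Trees.

(** The tree is given by an embedding instead of a subtype of the nodes, so
    that it can be compared with trees on any type of nodes; it is determined
    up to isomorphism by [tree_of_uniq]. *)
Definition tree_of (K V W : finType) (x : struct K V) (r : V)
    (T : struct 'I_1 W) :=
  exists e : W -> V,
    [/\ injective e, forall w, x.1 (e w) = omap e (T.1 w), e (T.2 ord0) = r
      & forall v, reach x v r = (v \in codom e)].

Lemma tree_of_exists (K V : finType) (x : struct K V) r : x.1 r = None ->
  exists (W : finType) (T : struct 'I_1 W), tree_of x r T.
Proof.
move=> rN; pose W : finType := {v | reach x v r}.
pose T : struct 'I_1 W :=
  ([ffun v => obind insub (x.1 (val v))],
   [ffun=> exist (fun v => reach x v r) r (reach0 x r)]).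
exists W, T, val; split; first exact: val_inj.
- case=> v vr; rewrite ffunE /=; case out_v: (x.1 v) => [w|] //=.
  by rewrite insubT //= -(reach_next rN out_v).
- by rewrite ffunE.
- move=> v; apply/idP/codomP => [vr|[w ->]]; last exact: valP w.
  by exists (exist (fun v => reach x v r) v vr).
Qed.

Lemma tree_of_isomap (K V V' W : finType) (x : struct K V) (y : struct K V')
    f r (T : struct 'I_1 W) :
  isomap x y f -> tree_of x r T -> tree_of y (f r) T.
Proof.
move=> f_iso [e [e_inj eo er ec]]; have [bf fo _] := f_iso.
exists (f \o e); split.
- exact: inj_comp (bij_inj bf) e_inj.
- by move=> w /=; rewrite fo eo; case: (T.1 w).
- by rewrite /= er.
- move=> v; have [g fK gK] := bf.
  rewrite -(gK v) (isomap_reach _ _ f_iso) ec; apply/codomP/codomP => -[w].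
    by move=> ->; exists w.
  by move=> /= /(bij_inj bf) ->; exists w.
Qed.

Lemma tree_of_iso (K V W W' : finType) (x : struct K V) r
    (T : struct 'I_1 W) (T' : struct 'I_1 W') :
  tree_of x r T -> iso T T' -> tree_of x r T'.
Proof.
move=> [e [e_inj eo er ec]] [f f_iso].
have [g [[bg go gm] fK gK]] := isomap_inv f_iso.
exists (e \o g); split.
- exact: inj_comp e_inj (bij_inj bg).
- by move=> w /=; rewrite eo go; case: (T'.1 w).
- by rewrite /= gm er.
- move=> v; rewrite ec; apply/codomP/codomP => -[w ->]; last by exists (g w).
  by exists (f w); rewrite /= fK.
Qed.

Lemma tree_of_uniq (K V W W' : finType) (x : struct K V) r
    (T : struct 'I_1 W) (T' : struct 'I_1 W') :
  tree_of x r T -> tree_of x r T' -> iso T T'.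
Proof.
move=> [e [e_inj eo er ec]] [e' [e'_inj e'o e'r e'c]].
have /choice[f fE] : forall w, exists w', e w = e' w'.
  by move=> w; apply/codomP; rewrite -e'c ec codom_f.
have /choice[g gE] : forall w, exists w', e' w = e w'.
  by move=> w; apply/codomP; rewrite -ec e'c codom_f.
exists f; split.
- by exists g => w; [apply: e_inj|apply: e'_inj]; rewrite -?gE -?fE // -gE.
- move=> w; have := eo w; rewrite fE e'o.
  case: (T.1 w) => [u|]; case: (T'.1 _) => [u'|] //= [].
  by rewrite fE => /e'_inj ->.
- move=> k; rewrite ord1; apply: e'_inj; rewrite -fE e'r -er.
  by congr e; rewrite [in RHS](_ : ord0 = k) // ord1.
Qed.

Lemma tree_of_rooted (K V W : finType) (x : struct K V) r
    (T : struct 'I_1 W) :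
  x.1 r = None -> tree_of x r T -> rooted ord0 T.
Proof.
move=> rN [e [e_inj eo er ec]]; split.
  by have := eo (T.2 ord0); rewrite er rN; case: (T.1 _).
suff gen v : reach x v r -> forall w, v = e w -> reach T w (T.2 ord0).
  by move=> w; apply: (gen (e w)) => //; rewrite ec codom_f.
move=> vr; elim/reach_ind: v / vr => [|u v uv _ IH] w def_w.
  by rewrite (e_inj w (T.2 ord0)) ?reach0 // er.
move: uv; rewrite def_w eo; case Tw: (T.1 w) => [w'|] //= [def_v].
exact: reach_step Tw (IH _ (esym def_v)).
Qed.

Section TreesOfUnion.
Variables (K K2 : finType) (kappa : K -> 'I_1 + K2) (V1 V2 : finType).
Variables (x1 : struct 'I_1 V1) (x2 : struct K2 V2).

Lemma tree_of_inr (W : finType) (T : struct 'I_1 W) b : x2.1 b = None ->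
  tree_of (union kappa x1 x2) (inr b) T <-> tree_of x2 b T.
Proof.
move=> bN.
have inr_tree (W' : finType) (T' : struct 'I_1 W') :
    tree_of x2 b T' -> tree_of (union kappa x1 x2) (inr b) T'.
  move=> [e [e_inj eo er ec]]; exists (inr \o e); split.
  - exact: inj_comp (@inr_inj _ _) e_inj.
  - by move=> w; rewrite union_out /= eo; case: (T'.1 w).
  - by rewrite /= er.
  - case=> [a|v]; last first.
      by rewrite reach_union_inr ec; apply/codomP/codomP => -[w];
        [move=> ->|case=> ->]; exists w.
    apply/idP/codomP => [/reach_union_side //|[]//].
split; last exact: inr_tree.
have [W' [T' T'_tree]] := tree_of_exists bN.
move=> T_tree; apply: (tree_of_iso T'_tree).
exact: tree_of_uniq (inr_tree _ _ T'_tree) T_tree.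
Qed.

Lemma tree_of_inl (W : finType) (T : struct 'I_1 W) :
  rooted ord0 x1 ->
  tree_of (union kappa x1 x2) (inl (x1.2 ord0)) T <-> iso x1 T.
Proof.
move=> x1r.
have inl_tree : tree_of (union kappa x1 x2) (inl (x1.2 ord0)) x1.
  exists inl; split; first exact: inl_inj.
  - by move=> w; rewrite union_out.
  - by [].
  - case=> [a|b]; first by rewrite reach_union_inl codom_f; case: x1r => _ ->.
    by apply/idP/codomP => [/reach_union_side //|[]//].
split; last exact: tree_of_iso.
exact: tree_of_uniq.
Qed.

End TreesOfUnion.

(** The trees above two roots are disjoint and no edge enters or leaves them,
    so that two isomorphic trees can be exchanged, all other nodes being fixed;
    the marks are preserved provided that they lie elsewhere. *)
Lemma tree_swap (K V W : finType) (x : struct K V) r s (T : struct 'I_1 W) :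
    x.1 r = None -> x.1 s = None -> r <> s -> tree_of x r T -> tree_of x s T ->
    (forall k, ~~ reach x (x.2 k) r /\ ~~ reach x (x.2 k) s) ->
  exists h, [/\ isomap x x h, h r = s, h s = r
    & forall v, ~~ reach x v r -> ~~ reach x v s -> h v = v].
Proof.
move=> rN sN neq_rs [e [e_inj eo er ec]] [e' [e'_inj e'o e'r e'c]] marks.
(* The subtypes are avoided: a node outside both trees is fixed by default. *)
pose h v := if [pick w | e w == v] is Some w then e' w else
            if [pick w | e' w == v] is Some w then e w else v.
have he w : h (e w) = e' w.
  rewrite /h; case: pickP => [w' /eqP /e_inj -> //|/(_ w)].
  by rewrite eqxx.
have disj w w' : e w <> e' w'.
  move=> eq_e; apply: neq_rs; apply: (reach_fun rN sN (v := e w)).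
    by rewrite ec codom_f.
  by rewrite eq_e e'c codom_f.
have he' w : h (e' w) = e w.
  rewrite /h; case: pickP => [w' /eqP /disj //|_].
  by case: pickP => [w' /eqP /e'_inj -> //|/(_ w)]; rewrite eqxx.
have hout v : ~~ reach x v r -> ~~ reach x v s -> h v = v.
  rewrite ec e'c => nev ne'v; rewrite /h; case: pickP => [w /eqP def_v|_].
    by rewrite -def_v codom_f in nev.
  case: pickP => [w /eqP def_v|//].
  by rewrite -def_v codom_f in ne'v.
have cases v : (exists w, v = e w) \/ (exists w, v = e' w) \/
    (~~ reach x v r /\ ~~ reach x v s).
  have [|nvr] := boolP (reach x v r); first by rewrite ec => /codomP; left.
  have [|nvs] := boolP (reach x v s); first by rewrite e'c => /codomP; right; left.
  by right; right.
have hK : involutive h.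
  move=> v; have [[w ->]|[[w ->]|[nr ns]]] := cases v.
  - by rewrite he he'.
  - by rewrite he' he.
  - by rewrite !hout.
exists h; split=> //; last 2 first.
- by rewrite -er he -e'r.
- by rewrite -e'r he' -er.
split; first by exists h.
- move=> v; have [[w ->]|[[w ->]|[nr ns]]] := cases v.
  + by rewrite he e'o eo; case: (T.1 w) => //= u; rewrite he.
  + by rewrite he' e'o eo; case: (T.1 w) => //= u; rewrite he'.
  + rewrite hout //; case out_v: (x.1 v) => [u|] //=.
    by rewrite hout // -?(reach_next rN out_v) -?(reach_next sN out_v).
- by move=> k; have [nr ns] := marks k; rewrite hout.
Qed.

(** Otherwise [tree_swap] would give an automorphism moving a root. *)
Lemma rigid_tree_inj (V W : finType) (x : struct 'I_0 V) r s
    (T : struct 'I_1 W) :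
    rigid x -> x.1 r = None -> x.1 s = None -> tree_of x r T ->
  tree_of x s T -> r = s.
Proof.
move=> x_rigid rN sN rT sT; apply: contrapT => neq_rs.
have [|h [h_iso hr _ _]] := tree_swap rN sN neq_rs rT sT; first by case.
by apply: neq_rs; rewrite -hr x_rigid.
Qed.

End Trees.

(** * Forests with pairwise distinct trees *)

Section AddingATree.
Variable S : struct_prop 'I_1.

Definition forest_in (P : struct_prop 'I_1) (k : nat) : struct_prop 'I_0 := fun V x =>
  rigid_roots k x /\
  forall r W (T : struct 'I_1 W), x.1 r = None -> tree_of x r T -> P W T.

Lemma forest_in_inv (P : struct_prop 'I_1) k : invariant (forest_in P k).
Proof.
move=> V W x y xy [xk xP]; split; first exact: rigid_roots_inv xy xk.
move=> r U T rN rT; have [g g_iso] := iso_sym xy.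
apply: xP (tree_of_isomap g_iso rT); exact/(isomap_root _ g_iso).
Qed.

Variables (n : nat) (tau : struct 'I_1 'I_n).
Hypotheses (tau_rooted : rooted ord0 tau) (ntau : ~ S tau).

Lemma num_classes_singleton i : num_classes (fun V (x : struct 'I_1 V) => iso x tau) i = (i == n).
Proof.
case: eqVneq => [->|neq_in]; last first.
  apply: num_classes0 => V x cardV /iso_card; rewrite cardV card_ord => eq_in.
  by rewrite eq_in eqxx in neq_in.
rewrite /num_classes /nclasses (_ : imset _ _ = [set class_of (@iso _ _ _) tau]).
  exact: cards1.
apply/setP => C; rewrite inE; apply/imsetP/eqP => [[x /[!inE]/asboolP x_tau ->]|->].
  by apply/class_ofP => //; apply: iso_equivalence.
by exists tau; rewrite // inE; apply/asboolP/iso_refl.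
Qed.

(** If [tau] occurs in a rigid structure, then it occurs once, and removing it
    leaves a structure in which it does not occur; conversely, adding [tau] to
    such a structure creates no pair of isomorphic trees. The root of [tau] is
    marked in order to apply [num_classes_peel]. *)
Lemma num_classes_forest_add k N :
  num_classes (forest_in (fun V T => S T \/ iso T tau) k) N =
  (num_classes (forest_in S k) N +
   if k is k'.+1 then
     \sum_(i < N.+1) (i == n :> nat) * num_classes (forest_in S k') (N - i)
   else 0)%N.
Proof.
pose Dr (V : finType) (x : struct 'I_0 V) r := x.1 r = None /\ tree_of x r tau.
have Dr_inv V W (x : struct 'I_0 V) (y : struct 'I_0 W) f r :
    isomap x y f -> Dr V x r -> Dr W y (f r).
  move=> f_iso [rN rT]; split; first exact/(isomap_root _ f_iso).
  exact: tree_of_isomap f_iso rT.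
rewrite (@num_classes_split _ _ (fun V x => exists r, Dr V x r)); last first.
  by move=> V W x y [f f_iso] [r /(Dr_inv _ _ _ _ _ _ f_iso)]; exists (f r).
rewrite addnC; congr addn.
  apply: eq_num_classes => V x; split=> [[[xk xS'] nD]|[xk xS]].
    split=> // r W T rN rT; have [//|T_tau] := xS' _ _ _ rN rT.
    by case: nD; exists r; split=> //; apply: tree_of_iso rT T_tau.
  split; first by split=> // r W T rN rT; left; apply: xS rN rT.
  by move=> [r [rN rT]]; apply: ntau; apply: xS rN rT.
case: k => [|k].
  apply: num_classes0 => V x _ [[[x0 _] _] [r [rN _]]].
  by move/eqP: x0; rewrite cards_eq0 => /eqP/setP/(_ r); rewrite !inE rN.
pose phi (i : 'I_1) : option 'I_0 := None.
pose phi' (o : option 'I_0) : 'I_1 := ord0.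
have phiK : cancel phi phi' by move=> i; rewrite [RHS]ord1.
have phi'K : cancel phi' phi by case=> [[]//|].
rewrite (num_classes_mark phiK phi'K _ Dr_inv) /phi'; last first.
  move=> V x v w [[_ x_rigid] _] [vN vT] [wN wT].
  exact: rigid_tree_inj vN wN vT wT.
under eq_bigr do rewrite -num_classes_singleton.
pose kappa : 'I_1 -> 'I_1 + 'I_0 := inl.
pose kappa' (z : 'I_1 + 'I_0) : 'I_1 := ord0.
have kappaK : cancel kappa kappa' by move=> i; rewrite [RHS]ord1.
have kappa'K : cancel kappa' kappa by case=> [i|[]//]; rewrite [i]ord1.
apply: (num_classes_peel kappaK kappa'K (k1 := ord0)).
- move=> V W x y [f f_iso] [Qx Dx].
  have [u_iso fm] := (isomap_unmark phiK _ _ _).1 f_iso.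
  split; first by apply: forest_in_inv Qx; exists f.
  by rewrite -fm; apply: Dr_inv u_iso Dx.
- by move=> V W x y xy x_tau; apply: iso_trans (iso_sym xy) x_tau.
- exact: forest_in_inv.
- by move=> V x1 /iso_sym x1_tau; apply: rooted_inv x1_tau tau_rooted.
- move=> V x [_ [xN _]]; split=> // i.
  by rewrite ord1 reach0.
move=> V1 V2 x1 x2 x1r; have root_u : (union kappa x1 x2).2 ord0 = inl (x1.2 ord0).
  by rewrite union_mark.
set u := union kappa x1 x2.
split=> [[[[uk u_rigid] uS] [uN uT]]|[x1_tau [x2k x2S]]].
  rewrite root_u in uN uT.
  split; first exact/(tree_of_inl kappa x2 _ x1r).
  split.
    apply/(rigid_roots_union kappa'K x2 x1r); split=> // f f_iso.
    by apply: u_rigid; case/(isomap_unmark phiK): f_iso.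
  move=> b W T bN bT.
  have bT' : tree_of u (inr b) T by apply/tree_of_inr.
  have ubN : u.1 (inr b) = None by apply/unionNone.
  have [//|T_tau] := uS (inr b) W T ubN bT'.
  have := rigid_tree_inj u_rigid uN ubN uT (tree_of_iso bT' T_tau).
  by [].
have uT : tree_of u (inl (x1.2 ord0)) tau by apply/tree_of_inl.
have uN : u.1 (inl (x1.2 ord0)) = None by apply/unionNone; case: x1r.
have [uk u_rigid] := (rigid_roots_union kappa'K x2 x1r _).2 x2k.
split; last by rewrite root_u.
split; first split=> //.
  move=> f f_iso; apply: u_rigid; apply/(isomap_unmark phiK); split=> //.
  rewrite root_u; have fN := (isomap_root _ f_iso).2 uN.
  have := tree_of_isomap f_iso uT.
  case: (f _) fN => [a|b] /(unionNone kappa) fN fT.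
    by congr inl; apply/(rooted_root _ x1r).
  (* If the root of [tau] moved, another root would carry the tree [tau]. *)
  case: ntau; apply: x2S (fN) _; exact/(tree_of_inr kappa x1 _ fN).
move=> [a|b] W T /(unionNone kappa) rN rT.
  have def_a : a = x1.2 ord0 by apply/(rooted_root _ x1r).
  right; apply: iso_trans x1_tau; apply: iso_sym.
  by apply/(tree_of_inl kappa x2 _ x1r); rewrite -def_a.
by left; apply: x2S (rN) _; apply/(tree_of_inr kappa x1 _ rN).
Qed.

End AddingATree.

(** * Recurrences for the numbers of classes *)

Section Recurrences.

Definition tree_count N := num_classes (@rooted 'I_1 ord0) N.
(** The mark [Some ord0] is the root and [None] is the marked node: the same
    shape as the result of [cut] on a structure with one mark. *)
Definition pointed_tree_count N := num_classes (@rooted (option 'I_1) (Some ord0)) N.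
Definition forest_count k N := num_classes (@rigid_roots 'I_0 k) N.
Definition pointed_forest_count k N := num_classes (@rigid_roots 'I_1 k) N.

Lemma reach_iso_mark (K : finType) (k l : K) :
  invariant (fun V (x : struct K V) => reach x (x.2 k) (x.2 l)).
Proof.
move=> V W x y [f f_iso]; have [_ _ fm] := f_iso.
by rewrite -!fm (isomap_reach _ _ f_iso).
Qed.

Lemma root_mark_inv (K : finType) (k : K) :
  invariant (fun V (x : struct K V) => x.1 (x.2 k) = None).
Proof.
move=> V W x y [f f_iso] xN; have [_ _ <-] := f_iso.
exact/(isomap_root _ f_iso).
Qed.

Lemma invariant_and (K : finType) (P Q : struct_prop K) :
  invariant P -> invariant Q -> invariant (fun V x => P V x /\ Q V x).
Proof.
by move=> invP invQ V W x y xy [Px Qx]; split; [apply: invP Px|apply: invQ Qx].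
Qed.

Lemma invariant_not (K : finType) (P : struct_prop K) :
  invariant P -> invariant (fun V x => ~ P V x).
Proof.
by move=> invP V W x y xy nPx Py; apply: nPx; apply: invP Py; apply: iso_sym.
Qed.

(** The other roots belong to the right part; nothing prevents one of their
    trees from being isomorphic to the tree above the marked root. *)
Lemma num_classes_root_marked k N :
  num_classes (fun V (x : struct 'I_1 V) => rigid_roots k.+1 x /\ x.1 (x.2 ord0) = None) N
  = (\sum_(i < N.+1) tree_count i * forest_count k (N - i))%N.
Proof.
pose kappa : 'I_1 -> 'I_1 + 'I_0 := inl.
pose kappa' (z : 'I_1 + 'I_0) : 'I_1 := ord0.
have kappaK : cancel kappa kappa' by move=> i; rewrite [RHS]ord1.
have kappa'K : cancel kappa' kappa by case=> [i|[]//]; rewrite [i]ord1.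
apply: (num_classes_peel kappaK kappa'K (k1 := ord0)).
- by apply: invariant_and; [apply: rigid_roots_inv|apply: root_mark_inv].
- exact: rooted_inv.
- exact: rigid_roots_inv.
- by [].
- by move=> V x [_ xN]; split=> // i; rewrite ord1 reach0.
move=> V1 V2 x1 x2 x1r; rewrite (rigid_roots_union kappa'K x2 x1r).
split=> [[x2k _]|[_ x2k]]; split=> //.
by rewrite union_mark; apply/(unionNone kappa); case: x1r.
Qed.

Lemma num_classes_root_marked0 N :
  num_classes (fun V (x : struct 'I_1 V) => rigid_roots 0 x /\ x.1 (x.2 ord0) = None) N
  = 0%N.
Proof.
apply: num_classes0 => V x _ [[x0 _] xN].
by move/eqP: x0; rewrite cards_eq0 => /eqP/setP/(_ (x.2 ord0)); rewrite !inE xN.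
Qed.

Local Notation cnode := (Some ord0 : option 'I_1).

(** The target of the cut edge is in the tree above the covertex exactly when
    the covertex was on a cycle. *)
Lemma num_classes_cut_cycle k N :
  num_classes (fun V (y : struct (option 'I_1) V) =>
         (y.1 (y.2 cnode) = None /\ rigid_roots k.+1 y)
         /\ reach y (y.2 None) (y.2 cnode)) N
  = (\sum_(i < N.+1) pointed_tree_count i * forest_count k (N - i))%N.
Proof.
pose kappa : option 'I_1 -> option 'I_1 + 'I_0 := inl.
pose kappa' (z : option 'I_1 + 'I_0) : option 'I_1 :=
  if z is inl o then o else None.
have kappaK : cancel kappa kappa' by [].
have kappa'K : cancel kappa' kappa by case=> [i|[]//].
apply: (num_classes_peel kappaK kappa'K (k1 := cnode)).
- apply: invariant_and; last exact: reach_iso_mark.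
  by apply: invariant_and; [apply: root_mark_inv|apply: rigid_roots_inv].
- exact: rooted_inv.
- exact: rigid_roots_inv.
- by [].
- move=> V x [[xN _] xr]; split=> // -[i|]; last exact: xr.
  by rewrite [i]ord1 reach0.
move=> V1 V2 x1 x2 x1r; rewrite (rigid_roots_union kappa'K x2 x1r).
rewrite !union_mark reach_union_inl.
split=> [[[_ x2k] _]|[_ x2k]]; split=> //; last by case: x1r.
by split=> //; apply/(unionNone kappa); case: x1r.
Qed.

Let kappa (o : option 'I_1) : 'I_1 + 'I_1 := if o is Some i then inl i else inr ord0.
Let kappa' (z : 'I_1 + 'I_1) : option 'I_1 :=
  if z is inl i then Some i else None.
Let kappaK : cancel kappa kappa'. Proof. by case. Qed.
Let kappa'K : cancel kappa' kappa.
Proof. by case=> [//|i] /=; rewrite [i]ord1. Qed.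

(** The covertex was not on a cycle: the target of the cut edge is in the right
    part, where it becomes the mark. *)
Lemma num_classes_cut_off (Q : struct_prop (option 'I_1)) (Q1 Q2 : struct_prop 'I_1) N :
    invariant Q -> invariant Q1 -> invariant Q2 ->
    (forall V (x1 : struct 'I_1 V), Q1 V x1 -> rooted ord0 x1) ->
    (forall V1 V2 (x1 : struct 'I_1 V1) (x2 : struct 'I_1 V2), rooted ord0 x1 ->
       Q _ (union kappa x1 x2) <-> Q1 _ x1 /\ Q2 _ x2) ->
  num_classes (fun V (y : struct (option 'I_1) V) =>
         (y.1 (y.2 cnode) = None /\ Q V y)
         /\ ~ reach y (y.2 None) (y.2 cnode)) N
  = (\sum_(i < N.+1) num_classes Q1 i * num_classes Q2 (N - i))%N.
Proof.
move=> invQ invQ1 invQ2 Q1r Qu.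
apply: (num_classes_peel kappaK kappa'K (k1 := ord0)) => //.
- apply: invariant_and; last exact/invariant_not/reach_iso_mark.
  by apply: invariant_and; first exact: root_mark_inv.
- move=> V x [[xN _] xr]; split=> // -[i|] /=; last exact/negbTE/negP.
  by rewrite [i]ord1 reach0.
move=> V1 V2 x1 x2 x1r; rewrite Qu // !union_mark /=.
split=> [[[]]//|[Q1x1 Q2x2]]; split; last by move/reach_union_side.
by split=> //; apply/(unionNone kappa); case: x1r.
Qed.

(** The three summands count the structures whose marked node is a root, lies
    on a cycle, or is any other node. *)
Lemma pointed_forest_rec k N :
  pointed_forest_count k N =
  ((if k is k'.+1 then
      \sum_(i < N.+1) tree_count i * forest_count k' (N - i)
    else 0)
   + (\sum_(i < N.+1) pointed_tree_count i * forest_count k (N - i)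
      + \sum_(i < N.+1) tree_count i * pointed_forest_count k (N - i)))%N.
Proof.
rewrite /pointed_forest_count.
rewrite (num_classes_split _ _ (@root_mark_inv 'I_1 ord0)); congr addn.
  by case: k => [|k]; [apply: num_classes_root_marked0|apply: num_classes_root_marked].
transitivity (num_classes (fun V (y : struct (option 'I_1) V) =>
    y.1 (y.2 cnode) = None /\ rigid_roots k.+1 y) N).
  rewrite -num_classes_cut; apply: eq_num_classes => V x.
  split=> -[]; last by move=> xN /(rigid_roots_cut _ xN).
  by move=> xk xN; split=> //; apply/(rigid_roots_cut _ xN).
rewrite (num_classes_split _ _ (@reach_iso_mark _ None cnode)) num_classes_cut_cycle.
congr addn; apply: num_classes_cut_off => //.
- exact: rigid_roots_inv.
- exact: rooted_inv.
- exact: rigid_roots_inv.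
move=> V1 V2 x1 x2 x1r; rewrite (rigid_roots_union kappa'K x2 x1r).
by split=> [|[]].
Qed.

Definition treelike (K V : finType) (x : struct K V) :=
  exists r, x.1 r = None /\ forall v, reach x v r.

Lemma treelike_inv (K : finType) : invariant (@treelike K).
Proof.
move=> V W x y [f f_iso] [r [rN xr]]; have [[g fK gK] _ _] := f_iso.
exists (f r); split; first exact/(isomap_root _ f_iso).
by move=> w; rewrite -(gK w) (isomap_reach _ _ f_iso).
Qed.

(** The root of a tree is determined by the tree, so that it need not be
    marked. *)
Lemma pointed_tree_treelike N : pointed_tree_count N = num_classes (@treelike 'I_1) N.
Proof.
pose phi (o : option 'I_1) : option 'I_1 := if o is Some i then None else Some ord0.
have phiK : cancel phi phi by case=> // i; rewrite [i]ord1.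
transitivity (num_classes (fun V (x : struct 'I_1 V) => True /\ treelike x) N); last first.
  by apply: eq_num_classes => V x; split=> [[]|].
rewrite (num_classes_mark phiK phiK).
- by apply: eq_num_classes => V x; split=> [|[]].
- move=> V W x y f r f_iso [rN xr]; have [[g fK gK] _ _] := f_iso.
  split; first exact/(isomap_root _ f_iso).
  by move=> w; rewrite -(gK w) (isomap_reach _ _ f_iso).
- move=> V x r s _ [rN xr] [sN xs].
  by apply: reach_fun rN sN (xr r) (xs r).
Qed.

(** A marked node which is not the root of a tree lies on no cycle; cutting its
    edge leaves two trees, and the edge went from one to the other. *)
Lemma treelike_cut (V : finType) (x : struct 'I_1 V) :
  x.1 (x.2 ord0) <> None ->
  treelike x <->
  (exists r, (cut ord0 x).1 r = None /\
     forall v, reach (cut ord0 x) v (x.2 ord0) \/ reach (cut ord0 x) v r)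
  /\ ~ reach (cut ord0 x) ((cut ord0 x).2 None) (x.2 ord0).
Proof.
move=> xN; set c := x.2 ord0; set y := cut ord0 x.
have cN : y.1 c = None by rewrite cut_out eqxx.
have [u c_out] : exists u, x.1 c = Some u.
  by move: xN; rewrite -/c; case: (x.1 c) => [u|//]; exists u.
have -> : y.2 None = u by rewrite cut_none -/c c_out.
have y_out v : v <> c -> y.1 v = x.1 v by rewrite cut_out => /eqP/negPf ->.
split=> [[r [rN xr]]|[[r [rN yr]] nuc]].
  have neq_rc : r <> c by move=> eq_rc; rewrite -eq_rc rN in c_out.
  split.
    exists r; rewrite y_out //; split=> // v.
    have vr := xr v; elim/reach_ind: v / vr => [|v w vw _ IH].
      by right; apply: reach0.
    have [->|/eqP neq_vc] := eqVneq v c; first by left; apply: reach0.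
    have {}vw : y.1 v = Some w by rewrite y_out.
    by case: IH => ?; [left|right]; apply: reach_step vw _.
  (* If the target led back to [c], so would every node reached from [c], and the
     root among them. *)
  move=> uc; suff gen v : reach x v r -> reach y v c -> reach y r c.
    have rc := gen c (xr c) (reach0 _ _); apply: neq_rc; apply/esym.
    by apply: reach_root rc; rewrite y_out // => eq_rc; rewrite eq_rc in rN xN.
  move=> vr; elim/reach_ind: v / vr => [//|v w vw _ IH] vc; apply: IH.
  have [eq_vc|/eqP neq_vc] := eqVneq v c.
    by move: vw; rewrite eq_vc c_out => -[<-].
  by rewrite -(reach_next cN (v := v)) // y_out.
have neq_rc : r <> c by move=> eq_rc; case: nuc; case: (yr u); rewrite ?eq_rc.
have y_x v w : reach y v w -> reach x v w.
  move=> vw; elim/reach_ind: v / vw => [|v v' vv' _ IH]; first exact: reach0.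
  apply: reach_step IH; rewrite -y_out // => eq_vc.
  by rewrite eq_vc cN in vv'.
have xcr : reach x c r.
  by apply: reach_step c_out _; apply: y_x; case: (yr u).
exists r; split=> [|v]; first by rewrite -y_out.
case: (yr v) => /y_x // vc; exact: connect_trans vc xcr.
Qed.

Lemma pointed_tree_rec N :
  pointed_tree_count N =
  (tree_count N
   + \sum_(i < N.+1) tree_count i * pointed_tree_count (N - i))%N.
Proof.
under eq_bigr do rewrite pointed_tree_treelike.
rewrite pointed_tree_treelike (num_classes_split _ _ (@root_mark_inv 'I_1 ord0)).
congr addn.
  apply: eq_num_classes => V x; split=> [[[r [rN xr]] xN]|[xN xr]].
    split=> // v; suff -> : x.2 ord0 = r by [].
    exact: reach_fun xN rN (reach0 _ _) (xr _).
  by split=> //; exists (x.2 ord0).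
pose Q : struct_prop (option 'I_1) := fun V y => exists r, y.1 r = None /\
     forall v, reach y v (y.2 cnode) \/ reach y v r.
transitivity (num_classes (fun V (y : struct (option 'I_1) V) =>
    y.1 (y.2 cnode) = None /\ (Q V y /\ ~ reach y (y.2 None) (y.2 cnode))) N).
  rewrite -num_classes_cut; apply: eq_num_classes => V x; rewrite /Q cut_some.
  split=> -[]; last by move=> xN /(treelike_cut xN).
  by move=> xk xN; split=> //; apply/(treelike_cut xN).
transitivity (num_classes (fun V (y : struct (option 'I_1) V) =>
    (y.1 (y.2 cnode) = None /\ Q V y) /\ ~ reach y (y.2 None) (y.2 cnode)) N).
  by apply: eq_num_classes => V y; split=> [[? []]|[[]]].
apply: num_classes_cut_off => //.
- move=> V W x y [f f_iso] [r [rN xr]]; have [[g fK gK] _ fm] := f_iso.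
  exists (f r); split; first exact/(isomap_root _ f_iso).
  by move=> w; rewrite -(gK w) -fm !(isomap_reach _ _ f_iso).
- exact: rooted_inv.
- exact: treelike_inv.
move=> V1 V2 x1 x2 x1r; rewrite /Q union_mark /=.
split=> [[[a|b] [/(unionNone kappa) rN xr]]|[_ [b [bN xb]]]].
- by have [] := xr (inr (x2.2 ord0)); move/reach_union_side.
- split=> //; exists b; split=> // v.
  by have [/reach_union_side //|] := xr (inr v); rewrite reach_union_inr.
- exists (inr b); split; first exact/(unionNone kappa).
  by case=> [a|v]; [left|right]; rewrite ?reach_union_inl ?reach_union_inr //;
     case: x1r.
Qed.

(** A covertex without predecessor becomes an isolated node when its edge is
    cut, and there is only one tree with one node. *)
Lemma num_classes_leaf_covertex N :
  num_classes (fun V (x : struct 'I_1 V) =>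
     rigid_roots 0 x /\ forall v, x.1 v <> Some (x.2 ord0)) N.+1
  = pointed_forest_count 0 N.
Proof.
pose leaf : struct_prop 'I_1 := fun V x => rooted ord0 x /\ #|V| = 1%N.
pose Q : struct_prop (option 'I_1) := fun V y => rigid_roots 1 y /\
  forall v, y.1 v <> Some (y.2 cnode).
transitivity (num_classes (fun V (y : struct (option 'I_1) V) =>
    (y.1 (y.2 cnode) = None /\ Q V y) /\ ~ reach y (y.2 None) (y.2 cnode)) N.+1).
  transitivity (num_classes (fun V (y : struct (option 'I_1) V) =>
    y.1 (y.2 cnode) = None /\ (Q V y /\ ~ reach y (y.2 None) (y.2 cnode))) N.+1);
    last by apply: eq_num_classes => V y; split=> [[? []]|[[]]].
  rewrite -num_classes_cut; apply: eq_num_classes => V x; rewrite /Q cut_some.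
  split=> [[[x0 xr] xleaf]|[xN [[xk xleaf] ureach]]].
    have xN : x.1 (x.2 ord0) <> None.
      move=> xN; move/eqP: x0.
      rewrite cards_eq0 => /eqP/setP/(_ (x.2 ord0)); by rewrite !inE xN.
    have cleaf v : (cut ord0 x).1 v <> Some (x.2 ord0).
      by rewrite cut_out; case: eqP => // _; apply: xleaf.
    split=> //; split; first by split=> //; apply/(rigid_roots_cut _ xN).
    move=> /reachE[].
      rewrite cut_none; case out_c: (x.1 _) xN => [w|//] _ /= def_w.
      by case: (xleaf (x.2 ord0)); rewrite out_c def_w.
    (* The last edge of a path to the covertex would come from a predecessor. *)
have noreach v w : (cut ord0 x).1 v = Some w ->
        reach (cut ord0 x) w (x.2 ord0) -> False.
      move=> + wc; elim/reach_ind: w / wc v => [|w w' ww' _ IH] v; first exact: cleaf.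
      by move=> _; apply: IH ww'.
    by case=> w; apply: noreach.
  split; first exact/(rigid_roots_cut _ xN).
  move=> v; have := xleaf v; rewrite cut_out; case: eqP => // -> _ out_c.
  by apply: ureach; rewrite cut_none out_c reach0.
rewrite (num_classes_cut_off (Q1 := leaf) (Q2 := @rigid_roots 'I_1 0)).
- rewrite big_ord_recl big_ord_recl big1 ?addn0 => [|i _]; last first.
    rewrite (_ : num_classes _ _ = 0%N) //; apply: num_classes0 => V x cardV [_].
    by rewrite cardV.
  rewrite (_ : num_classes leaf _ = 0%N) ?mul0n ?add0n; last first.
    by apply: num_classes0 => V x cardV [_]; rewrite cardV.
  rewrite /bump /= subn1 /= (_ : num_classes leaf 1 = 1%N) ?mul1n //.
  pose tau : struct 'I_1 'I_1 := ([ffun=> None], [ffun=> ord0]).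
  transitivity (num_classes (fun V (x : struct 'I_1 V) => iso x tau) 1%N); last exact: num_classes_singleton.
  have tau_r : rooted ord0 tau.
    by split=> [|v]; rewrite ?ffunE //= ?ffunE // [v]ord1 reach0.
  apply: eq_num_classes => V x; split=> [[xr V1]|x_tau]; last first.
    split; first by apply: rooted_inv (iso_sym x_tau) tau_r.
    by rewrite (iso_card x_tau) card_ord.
  have [y xy] := iso_ord x V1; apply: iso_trans (xy) _.
  have [yN _] := rooted_inv xy xr.
  exists id; split; first by exists id.
    move=> v; rewrite /= ffunE (_ : v = y.2 ord0) ?yN //.
    by rewrite [LHS]ord1 [RHS]ord1.
  by move=> k; rewrite /= ffunE [LHS]ord1.
- move=> V W x y xy [xk xleaf]; split; first exact: rigid_roots_inv xy xk.
  move=> w; have [f f_iso] := xy; have [[g fK gK] fo fm] := f_iso.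
  rewrite -(gK w) fo -fm; case out_g: (x.1 (g w)) => [v|] //= -[/(can_inj fK) eq_v].
  by apply: (xleaf (g w)); rewrite out_g eq_v.
- move=> V W x y xy [xr cardV]; split; first exact: rooted_inv xy xr.
  by rewrite -(iso_card xy).
- exact: rigid_roots_inv.
- by move=> V x [].
move=> V1 V2 x1 x2 x1r; rewrite /Q (rigid_roots_union kappa'K x2 x1r).
rewrite union_mark [kappa _]/=; split=> [[x2k xleaf]|[[_ V11] x2k]]; split=> //.
  split=> //; rewrite -(cards1 (x1.2 ord0)) -cardsT; apply: eq_card => v.
  rewrite !inE; apply/esym/eqP; have [_ /(_ v)] := x1r.
  move=> vr; elim/reach_ind: v / vr => // v w vw _ def_w.
  by case: (xleaf (inl v)); rewrite union_out vw /= def_w.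
case=> [a|b]; rewrite union_out; last by case: (x2.1 b).
have /card_le1_eqP V1_eq := eq_leq V11.
have -> : a = x1.2 ord0 by apply: V1_eq.
by case: x1r => ->.
Qed.

End Recurrences.

(** * Bases and alternating sums *)

Local Open Scope ring_scope.
Local Open Scope quotient_scope.

Section LinearAlgebra.
Variables (R : realType).

(** The vectors are indexed by a part of the basis, and each of them is the
    only one with a nonzero coordinate at its own index. *)
Lemma dim_span_diag (X : finType) (l : seq X) (b : X -> {ffun X -> R^o}) :
    uniq l -> (forall x, x \in l -> b x x != 0) ->
    (forall x y, x \in l -> y \in l -> x != y -> b x y = 0) ->
  \dim <<map b l>> = size l.
Proof.
move=> l_uniq diag off; rewrite -(size_map b l); apply/eqP.
rewrite -[_ == _]/(free (map b l)) -(in_tupleE (map b l)).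
apply/freeP => k sum0 i.
have lt_i : (i < size l)%N by rewrite -(size_map b).
have [x0 _] : exists x0 : X, true by have := leq_ltn_trans (leq0n _) lt_i; case: (l) => // x; exists x.
pose x := nth x0 l i.
have xl : x \in l by apply: mem_nth.
have /ffunP/(_ x) := sum0; rewrite sum_ffunE ffunE (bigD1 i) //= big1.
  rewrite addr0 ffunE (nth_map x0) // -/x => /eqP.
  by rewrite mulf_eq0 (negPf (diag x xl)) orbF => /eqP.
move=> j neq_ji; have lt_j : (j < size l)%N by rewrite -(size_map b).
rewrite ffunE (nth_map x0) // off ?mem_nth //; first exact: mulr0.
by rewrite nth_uniq.
Qed.

Lemma lin_extE n p N (W : vectType R) (f : forest n p N -> W) w :
  lin_ext f w = \sum_x (w : {ffun _ -> R^o}) x *: f x.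
Proof. by rewrite lfunE. Qed.

Lemma lin_ext_basis n p N (W : vectType R) (f : forest n p N -> W) x :
  lin_ext f (basis_vec R x) = f x.
Proof.
rewrite lin_extE (bigD1 x) //= ffunE eqxx scale1r big1 ?addr0 // => y neq_yx.
by rewrite ffunE (negPf neq_yx) scale0r.
Qed.

Lemma forest_space_basis n p N (w : forest_space R n p N) :
  w = \sum_x (w : {ffun _ -> R^o}) x *: basis_vec R x.
Proof.
apply/ffunP => y; rewrite sum_ffunE (bigD1 y) //= big1 => [|x neq_xy].
  by rewrite !ffunE eqxx addr0; apply/esym/mulr1.
by rewrite !ffunE eq_sym (negPf neq_xy); apply: mulr0.
Qed.

Lemma limg_lin_ext n p N (W : vectType R) (f : forest n p N -> W) :
  limg (lin_ext f) = <<codom f>>%VS.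
Proof.
apply: subv_anti; apply/andP; split.
  apply/subvP => _ /memv_imgP[w _ ->]; rewrite lin_extE.
  apply: memv_suml => x _; apply: memvZ; apply: memv_span; exact: codom_f.
apply/span_subvP => _ /codomP[x ->]; rewrite -lin_ext_basis.
exact/memv_img/memvf.
Qed.

(** The alternating sum over the orbit of [x] vanishes when an odd permutation
    fixes [x]; otherwise its coordinate at [x] is, up to [1 / n!], the order of
    the stabilizer. Sums over different orbits have disjoint supports. *)
Lemma dim_alternating (X : finType) n (act : 'S_n -> X -> X) :
    (forall x, act 1%g x = x) ->
    (forall s t x, act t (act s x) = act (s * t)%g x) ->
  \dim <<codom (fun x => (n`!%:R : R)^-1 *: \sum_(s : 'S_n) (-1) ^+ s *:
            ([ffun y => (y == act s x)%:R] : {ffun X -> R^o}))>> =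
  nclasses (fun x y => exists s, y = act s x)
           (fun x => forall s : 'S_n, act s x = x -> odd_perm s = false).
Proof.
move=> act1 actM; set wv := fun x : X => (n`!%:R : R)^-1 *: _; set E := fun x y : X => _.
set P := fun x : X => _.
have eqE : equivalence_prop E.
  split=> [x|x _ [s ->]|x _ _ [s ->] [t ->]]; first by exists 1%g.
    by exists s^-1%g; rewrite actM mulgV act1.
  by exists (s * t)%g; rewrite actM.
have wvE x y : wv x y = (n`!%:R)^-1 * \sum_(s : 'S_n | y == act s x) (-1) ^+ s.
  rewrite /wv ffunE sum_ffunE [in RHS]big_mkcond /=; congr (_ * _).
  apply: eq_bigr => s _; rewrite !ffunE; case: ifP => _; [exact: mulr1|exact: mulr0].
have fact_neq0 : (n`!%:R : R)^-1 != 0 by rewrite invr_eq0 pnatr_eq0 -lt0n fact_gt0.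
have wv_act t x : wv (act t x) = (-1) ^+ t *: wv x.
  apply/ffunP => y; rewrite [RHS]ffunE !wvE [RHS]mulrCA; congr (_ * _).
  rewrite mulr_sumr (reindex_inj (mulgI t^-1%g)) /=.
  apply: eq_big => [s|s _]; first by rewrite actM mulKVg.
  by rewrite odd_permM odd_permV signr_addb.
(* An odd permutation fixing [x] makes [wv x] equal to its opposite. *)
have wv0 x : ~ P x -> wv x = 0.
  move=> nP; have [s [sx s_odd]] : exists s, act s x = x /\ odd_perm s.
    apply: contrapT => nex; apply: nP => s sx.
    by apply/negbTE/negP => s_odd; apply: nex; exists s.
  have := wv_act s x; rewrite sx s_odd expr1 scaleN1r => /eqP.
  rewrite -addr_eq0 => /eqP wv2; apply/ffunP => y; rewrite [RHS]ffunE.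
  have /ffunP/(_ y) := wv2; rewrite !ffunE -mulr2n => /eqP.
  by rewrite mulrn_eq0 => /eqP.
have [l [size_l lP lE lpair]] := nclasses_reps P eqE.
rewrite -size_l -(dim_span_diag (b := wv) (l := l)); first last.
- move=> x y xl yl neq_xy; rewrite wvE big1 ?mulr0 // => s /eqP def_y.
  have Exy : E x y by exists s.
  have Eyx : E y x by case: eqE => _ Es _; apply: Es.
  have [_ Es _] := eqE.
  case: (ltngtP (index x l) (index y l)) => lt_xy.
  + have /(pairwiseP x) /(_ (index x l) (index y l)) := lpair.
    rewrite !inE !index_mem !nth_index // => /(_ xl yl lt_xy)/negP[].
    exact/asboolP.
  + have /(pairwiseP x) /(_ (index y l) (index x l)) := lpair.
    rewrite !inE !index_mem !nth_index // => /(_ yl xl lt_xy)/negP[].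
    exact/asboolP.
  + case/eqP: neq_xy; rewrite -(nth_index x xl) lt_xy.
    exact: nth_index.
- move=> x /lP Px; rewrite wvE mulf_neq0 //.
  rewrite (eq_bigr (fun=> 1)) => [|s /eqP sx]; last first.
    by rewrite (Px s (esym sx)).
  rewrite sumr_const pnatr_eq0 -lt0n; apply/card_gt0P; exists 1%g.
  by rewrite unfold_in /= act1; exact: eqxx.
- elim: (l) lpair => //= x l' IH /andP[/allP xl' /IH ->]; rewrite andbT.
  apply/negP => /xl' /negP[]; apply/asboolP; by case: eqE.
congr (\dim _); apply: subv_anti; apply/andP; split; last first.
  by apply/span_subvP => _ /mapP[x _ ->]; apply: memv_span; apply: codom_f.
apply/span_subvP => _ /codomP[x ->].
have [Px|/wv0 ->] := pselect (P x); last exact: mem0v.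
have [y yl [s def_y]] := lE x Px.
have -> : x = act s^-1%g y by rewrite def_y actM mulgV act1.
by rewrite wv_act memvZ // memv_span // map_f.
Qed.

End LinearAlgebra.

(** * Forests and structures *)

Local Notation root := Defs.root.

Section Forests.
Variables (n p N : nat).
Implicit Types (g h : graph n p N) (x : forest n p N).

Definition forget g : struct 'I_p 'I_N := (out g, covertex g).

Lemma graph_eq g h :
  out g = out h -> root g = root h -> covertex g = covertex h -> g = h.
Proof.
case: g h => [[[o r] c] ax_g] [[[o' r'] c'] ax_h]; rewrite /out /root /covertex /=.
by move=> eq_o eq_r eq_c; apply: val_inj; rewrite /= eq_o eq_r eq_c.
Qed.

Lemma root_inj g : injective (root g).
Proof. by have /and3P[/injectiveP] := valP g. Qed.

Lemma covertex_inj g : injective (covertex g).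
Proof. by have /and3P[_ _ /injectiveP] := valP g. Qed.

Lemma out_rootP g v : out g v = None <-> exists i, v = root g i.
Proof.
have /and3P[_ /forallP/(_ v)/eqP ax _] := valP g.
rewrite -[LHS]/(out g v == None) in ax.
split=> [/eqP|[i def_v]]; first by rewrite ax => /codomP.
by apply/eqP; rewrite ax; apply/codomP; exists i.
Qed.

Lemma out_root g i : out g (root g i) = None.
Proof. by apply/out_rootP; exists i. Qed.

Lemma graph_isoP g h :
  graph_iso g h <-> exists f, isomap (forget g) (forget h) f /\
                              forall i, root h i = f (root g i).
Proof.
split=> [/existsP[s /and3P[/forallP so /forallP sr /forallP sc]]|].
  exists s; split=> [|i]; last exact/eqP.
  split; first by exists s^-1%g; [apply: permK|apply: permKV].
    by move=> v; rewrite (eqP (so v)).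
  by move=> k; rewrite (eqP (sc k)).
move=> [f [[bf fo fm] fr]]; apply/existsP; exists (perm (bij_inj bf)).
apply/and3P; split; apply/forallP => v; rewrite !permE.
- rewrite [out h _]fo /=; case: (out g v) => //= w; by rewrite permE.
- exact/eqP.
- by rewrite -fm.
Qed.

Lemma pi_isoP g h : \pi_(forest n p N) g = \pi_(forest n p N) h <-> graph_iso g h.
Proof. by split=> [/eqmodP|?]; last exact/eqmodP. Qed.

Lemma repr_iso g : graph_iso (repr (\pi_(forest n p N) g)) g.
Proof. by apply/pi_isoP; rewrite reprK. Qed.

Lemma nroots_forget g : nroots (forget g) = n.
Proof.
rewrite /nroots -[RHS](card_ord n) -(card_codom (@root_inj g)).
apply: eq_card => v; rewrite !inE; apply/eqP/codomP => [/out_rootP//|[i ->]].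
exact: out_root.
Qed.

(** The bound on [p] is needed because the marks of a structure may coincide,
    while covertices are distinct. *)
Lemma forget_realize (y : struct 'I_p 'I_N) : (p <= 1)%N -> nroots y = n ->
  exists g, forget g = y.
Proof.
move=> p1 yn; have yn' : n = #|[set v | y.1 v == None]| by [].
pose r : {ffun 'I_n -> 'I_N} := [ffun i => enum_val (cast_ord yn' i)].
have ax : graph_axiom (y.1, r, y.2).
  apply/and3P; split=> /=.
  - by apply/injectiveP => i j; rewrite !ffunE => /enum_val_inj/cast_ord_inj.
  - apply/forallP => v; apply/eqP; apply/eqP/codomP => [vN|[i ->]].
      have v_in : v \in [set v | y.1 v == None] by rewrite inE vN.
      exists (cast_ord (esym yn') (enum_rank_in v_in v)).
      by rewrite ffunE cast_ordKV enum_rankK_in.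
    by rewrite ffunE; have := enum_valP (cast_ord yn' i); rewrite inE => /eqP.
  - apply/injectiveP => i j _; apply: val_inj.
    by move: (ltn_ord i) (ltn_ord j) p1 => /=; case: (p) i j => [|[|]] // [[|]] // ? [[|]].
exists (Graph ax); rewrite /forget /out /covertex /=.
by rewrite -surjective_pairing.
Qed.

(** * Permutations of the roots *)

Definition act_roots (s : 'S_n) x : forest n p N :=
  \pi_(forest n p N) (permute_roots s (repr x)).

Lemma root_permute s g i : root (permute_roots s g) i = root g (s^-1%g i).
Proof. by rewrite /root /= ffunE. Qed.
Lemma permute_roots_iso s g h :
  graph_iso g h -> graph_iso (permute_roots s g) (permute_roots s h).
Proof.
move=> /graph_isoP[f [f_iso fr]]; apply/graph_isoP; exists f; split=> // i.
by rewrite !root_permute fr.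
Qed.

Lemma act_rootsE s g :
  act_roots s (\pi_(forest n p N) g) = \pi_(forest n p N) (permute_roots s g).
Proof. exact/pi_isoP/permute_roots_iso/repr_iso. Qed.

Lemma act_roots1 x : act_roots 1%g x = x.
Proof.
rewrite -[x in RHS]reprK; congr (\pi_(forest n p N) _).
apply: graph_eq => //; apply/ffunP => i.
by rewrite root_permute invg1 perm1.
Qed.

Lemma act_rootsM s t x : act_roots t (act_roots s x) = act_roots (s * t)%g x.
Proof.
rewrite {2}/act_roots act_rootsE; congr (\pi_(forest n p N) _).
apply: graph_eq => //; apply/ffunP => i.
by rewrite !root_permute invMg permM.
Qed.

Lemma isomap_forget_perm g h f : isomap (forget g) (forget h) f ->
  exists s : 'S_n, graph_iso (permute_roots s g) h.
Proof.
move=> f_iso; have [bf fo _] := f_iso.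
have /choice[s0 s0E] : forall i, exists j, f (root g i) = root h j.
  move=> i; apply/out_rootP; apply/(isomap_root _ f_iso); exact: out_root.
have s0_inj : injective s0.
  by move=> i j eq_s; apply/(@root_inj g)/(bij_inj bf); rewrite !s0E eq_s.
exists (perm s0_inj); apply/graph_isoP; exists f; split=> // i.
by rewrite root_permute s0E -{1}(permKV (perm s0_inj) i) permE.
Qed.

(** For the converse direction: an automorphism moving a root provides two
    isomorphic trees above roots; they contain no covertex, because covertices
    are fixed, and exchanging them acts on the roots by a transposition. *)
Lemma rigid_forgetP g :
  rigid (forget g) <->
  forall s : 'S_n, graph_iso (permute_roots s g) g -> odd_perm s = false.
Proof.
split=> [g_rigid s /graph_isoP[f [f_iso fr]]|no_odd f f_iso v vN].
  suff -> : s = 1%g by rewrite odd_perm1.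
  apply/permP => i; rewrite perm1; apply: (@root_inj g).
  by rewrite fr root_permute permK; apply: g_rigid f_iso _ _; apply: out_root.
apply: contrapT => fv_neq.
have [i def_v] := (out_rootP g v).1 vN.
have fvN : (forget g).1 (f v) = None by apply/(isomap_root _ f_iso).
have [j def_fv] := (out_rootP g (f v)).1 fvN.
have [W [T vT]] := tree_of_exists vN.
have fvT := tree_of_isomap f_iso vT.
have marks k : ~~ reach (forget g) ((forget g).2 k) v /\
               ~~ reach (forget g) ((forget g).2 k) (f v).
  have [_ _ fm] := f_iso.
  have one : reach (forget g) ((forget g).2 k) v =
             reach (forget g) ((forget g).2 k) (f v).
    by rewrite -[in RHS]fm (isomap_reach _ _ f_iso).
  rewrite -one; suff /negbTE-> : ~~ reach (forget g) ((forget g).2 k) v by [].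
  apply/negP => kv; apply: fv_neq; apply: reach_fun fvN vN _ (kv).
  by rewrite -one.
have [|h [h_iso hv hfv hout]] := tree_swap vN fvN _ vT fvT marks.
  by move=> eq_v; apply: fv_neq; rewrite -eq_v.
have neq_ij : i != j.
  by apply/eqP => eq_ij; apply: fv_neq; rewrite def_fv -eq_ij.
have : odd_perm (tperm i j) = false.
  apply: no_odd; apply/graph_isoP; exists h; split=> // k.
  rewrite root_permute tpermV; case: tpermP => [->|->|neq_ki neq_kj].
  - by rewrite -def_fv hfv def_v.
  - by rewrite -def_v hv def_fv.
  - rewrite hout //; apply/negP => /reach_root; rewrite ?def_fv ?def_v.
      by move=> /(_ (out_root _ _))/(@root_inj g)/esym.
    by move=> /(_ (out_root _ _))/(@root_inj g)/esym.
by rewrite odd_tperm neq_ij.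
Qed.

(** An isomorphism of the structures obtained by forgetting the numbers of the
    roots is an isomorphism of forests up to a permutation of the roots. *)
Lemma nclasses_act_roots : (p <= 1)%N ->
  nclasses (fun x y => exists s, y = act_roots s x)
    (fun x => forall s : 'S_n, act_roots s x = x -> odd_perm s = false)
  = num_classes (@rigid_roots 'I_p n) N.
Proof.
move=> p1.
have good_rigid x : rigid (forget (repr x)) <->
    forall s : 'S_n, act_roots s x = x -> odd_perm s = false.
  rewrite rigid_forgetP; split=> H s.
    move=> sx; apply: H; apply/pi_isoP; rewrite reprK; exact: sx.
  by move=> /pi_isoP; rewrite reprK => sx; apply: H.
apply: (nclasses_corr (R := fun x y => iso (forget (repr x)) y)).
- split=> [x|x _ [s ->]|x _ _ [s ->] [t ->]].
  + by exists 1%g; rewrite act_roots1.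
  + by exists s^-1%g; rewrite act_rootsM mulgV act_roots1.
  + by exists (s * t)%g; rewrite act_rootsM.
- exact: iso_equivalence.
- move=> x /good_rigid x_rigid; exists (forget (repr x)); last exact: iso_refl.
  by split=> //; apply: nroots_forget.
- move=> y [yn y_rigid]; have [g def_y] := forget_realize p1 yn.
  exists (\pi_(forest n p N) g).
    apply/good_rigid; have /graph_isoP[f [f_iso _]] := repr_iso g.
    by apply: (@rigid_inv _ _ _ y); rewrite // -def_y; apply: iso_sym; exists f.
  by have /graph_isoP[f [f_iso _]] := repr_iso g; exists f; rewrite -def_y.
- move=> x y x' y' _ _ _ _ xy xy'; split=> [[s def_x']|yy'].
    apply: iso_trans (iso_sym xy) _; apply: iso_trans xy'.
    have /graph_isoP[f [f_iso _]] := repr_iso (permute_roots s (repr x)).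
    by apply: iso_sym; rewrite def_x'; exists f.
  have [f f_iso] : iso (forget (repr x)) (forget (repr x')).
    by apply: iso_trans xy (iso_trans yy' (iso_sym xy')).
  have [s s_iso] := isomap_forget_perm f_iso; exists s.
  by rewrite -[LHS]reprK; apply/esym/pi_isoP.
Qed.

Lemma perm_small (s : 'S_p) : (p <= 1)%N -> s = 1%g.
Proof.
move=> p1; apply/permP => i; rewrite perm1; apply: val_inj => /=.
by have := ltn_ord (s i); have := ltn_ord i; lia.
Qed.

Lemma dim_Omega (R : realType) : (p <= 1)%N ->
  \dim (Omega R n p N) = num_classes (@rigid_roots 'I_p n) N.
Proof.
move=> p1; rewrite /Omega /wedge.
have -> : wedge_covertices R n p N = \1%VF.
  apply/lfunP => w; rewrite id_lfunE /wedge_covertices [w in RHS]forest_space_basis.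
  rewrite lin_extE; apply: eq_bigr => x _; congr (_ *: _).
  rewrite (big_pred1 1%g) => [|s]; last by rewrite (perm_small s p1); apply/esym/eqxx.
  rewrite odd_perm1 scale1r (_ : p`! = 1)%N ?invr1 ?scale1r; last first.
    by case: (p) p1 => [|[|]].
  congr basis_vec; rewrite -[RHS]reprK; congr (\pi_(forest n p N) _).
  apply: graph_eq => //; apply/ffunP => i.
  by rewrite /covertex /= ffunE invg1 perm1.
rewrite comp_lfun1r limg_lin_ext -nclasses_act_roots // -(dim_alternating R).
- by [].
- exact: act_roots1.
- exact: act_rootsM.
Qed.

End Forests.

(** * Forests with at most one root *)

Section SmallForests.
Variables (n p N : nat).
Hypotheses (n1 : (n <= 1)%N) (p1 : (p <= 1)%N).
Implicit Types (g h : graph n p N) (x : forest n p N).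

Lemma graph_iso_forget g h : graph_iso g h <-> iso (forget g) (forget h).
Proof.
split=> [/graph_isoP[f [f_iso _]]|[f /isomap_forget_perm[s]]]; first by exists f.
rewrite (perm_small s n1) (_ : permute_roots 1 g = g) //.
apply: graph_eq => //; apply/ffunP => i.
by rewrite root_permute invg1 perm1.
Qed.

(** With at most one root there is nothing to forget. *)
Lemma card_forest (b : pred (forest n p N)) (Q : struct_prop 'I_p) :
    invariant Q -> (forall x, b x <-> Q _ (forget (repr x))) ->
  #|[set x | b x]| = num_classes (fun V y => nroots y = n /\ Q V y) N.
Proof.
move=> invQ bQ.
have -> : #|[set x | b x]| = nclasses (@eq (forest n p N)) b.
  rewrite /nclasses -(card_imset _ set1_inj).
  rewrite (_ : [set x | `[< b x >]] = [set x | b x]); last first.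
    by apply/setP => x; rewrite !inE asboolb.
  rewrite (eq_imset (g := @set1 _)) // => x.
  apply/setP => y; rewrite !inE; apply/asboolP/eqP => //.
apply: (nclasses_corr (R := fun x y => iso (forget (repr x)) y)).
- by split=> // x y z -> ->.
- exact: iso_equivalence.
- move=> x /bQ Qx; exists (forget (repr x)); last exact: iso_refl.
  by split=> //; apply: nroots_forget.
- move=> y [yn Qy]; have [g def_y] := forget_realize p1 yn.
  have g_iso := (graph_iso_forget _ _).1 (repr_iso g).
  exists (\pi_(forest n p N) g); last by rewrite -def_y.
  by apply/bQ/(invQ _ _ _ _ (iso_sym g_iso)); rewrite def_y.
- move=> x y x' y' _ _ _ _ xy xy'; split=> [eq_x|yy'].
    by rewrite -eq_x in xy'; apply: iso_trans (iso_sym xy) xy'.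
  rewrite -[x]reprK -[x']reprK; apply/pi_isoP/graph_iso_forget.
  exact: iso_trans xy (iso_trans yy' (iso_sym xy')).
Qed.

End SmallForests.

Lemma num_rooted_treesE N : num_rooted_trees N = tree_count N.
Proof.
rewrite /num_rooted_trees (@card_forest 1 0 N _ _ _ (@treelike 'I_0)) //; first last.
- move=> x; split=> [/forallP x_tree|[r [rN xr]]].
    by exists (root (repr x) ord0); split=> //; apply: out_root.
  have [i def_r] := (out_rootP (repr x) r).1 rN.
  by apply/forallP => v; rewrite -[ord0](ord1 i) -def_r; apply: xr.
- exact: treelike_inv.
pose phi (i : 'I_1) : option 'I_0 := None.
pose phi' (o : option 'I_0) : 'I_1 := ord0.
have phiK : cancel phi phi' by move=> i; rewrite [RHS]ord1.
have phi'K : cancel phi' phi by case=> [[]//|].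
rewrite (num_classes_mark phiK phi'K).
- apply: eq_num_classes => V x; split=> [[_ []]//|x_rooted].
  split; last by case: x_rooted.
  exact: (nroots_rooted x_rooted).
- move=> V W x y f r f_iso [rN xr]; have [[g fK gK] _ _] := f_iso.
  split; first exact/(isomap_root _ f_iso).
  by move=> w; rewrite -(gK w) (isomap_reach _ _ f_iso).
- move=> V x r s _ [rN xr] [sN xs].
  by apply: reach_fun rN sN (xr r) (xs r).
Qed.

Lemma root_unique (K V : finType) (x : struct K V) v w :
  (nroots x <= 1)%N -> x.1 v = None -> x.1 w = None -> v = w.
Proof. by move=> /card_le1_eqP x1 vN wN; apply: x1; rewrite inE ?vN ?wN. Qed.

Lemma rigid_small (K V : finType) (x : struct K V) :
  (nroots x <= 1)%N -> rigid x.
Proof.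
move=> x1 f f_iso v vN; apply: root_unique x1 _ (vN).
exact/(isomap_root _ f_iso).
Qed.

(** A forest with one root consists of the tree above this root and of a forest
    without roots. *)
Lemma forest_count1 N :
  forest_count 1 N = (\sum_(i < N.+1) tree_count i * forest_count 0 (N - i))%N.
Proof.
rewrite -num_classes_root_marked.
pose phi (i : 'I_1) : option 'I_0 := None.
pose phi' (o : option 'I_0) : 'I_1 := ord0.
have phiK : cancel phi phi' by move=> i; rewrite [RHS]ord1.
have phi'K : cancel phi' phi by case=> [[]//|].
transitivity (num_classes (fun V (x : struct 'I_0 V) =>
    rigid_roots 1 x /\ exists v, x.1 v = None) N).
  apply: eq_num_classes => V x; split=> [[x1 xr]|[]//]; split=> //.
  have /card_gt0P[v] : (0 < nroots x)%N by rewrite x1.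
  by rewrite inE => /eqP vN; exists v.
rewrite (num_classes_mark phiK phi'K).
- by apply: eq_num_classes => V x; split=> [[[x1 _] xN]|[[x1 _] xN]]; split=> //;
    split=> //; apply: rigid_small; apply: eq_leq; apply: x1.
- by move=> V W x y f v f_iso vN; apply/(isomap_root _ f_iso).
- by move=> V x v w [x1 _]; apply: root_unique; rewrite x1.
Qed.

Section Dimensions.
Variable R : realType.

Lemma dim_forest_space n p N :
  \dim {: forest_space R n p N} = #|{: forest n p N}|.
Proof.
rewrite cardE -(dim_span_diag (b := @basis_vec R n p N) (l := enum predT)).
- congr (\dim _); apply/esym/eqP; rewrite eqEsubv subvf /=; apply/subvP => w _.
  rewrite [w]forest_space_basis; apply: memv_suml => x _.
  by rewrite memvZ // memv_span // map_f // mem_enum.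
- exact: enum_uniq.
- by move=> x _; rewrite ffunE eqxx oner_eq0.
- by move=> x y _ _ neq_xy; rewrite ffunE eq_sym (negPf neq_xy).
Qed.

Lemma Omega_small n p N : (n <= 1)%N -> (p <= 1)%N -> Omega R n p N = fullv.
Proof.
move=> n1 p1; apply/eqP; rewrite eqEdim subvf /= dim_Omega // dim_forest_space.
rewrite -[#|_|](@eq_card _ [set x : forest n p N | true]); last first.
  by move=> x; rewrite !inE.
rewrite (card_forest n1 p1 (Q := fun _ _ => True)) //.
rewrite leq_eqVlt; apply/orP; left; apply/eqP; apply: eq_num_classes => V x.
by split=> [[xn _]|[xn _]]; split=> //; apply: rigid_small; rewrite xn.
Qed.

(** * The rank of the horizontal differential *)

Section Solenoidal.
Variable N : nat.
Local Notation space0 := (forest_space R 0 0 N).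

Definition relabel n p (s : {perm 'I_N}) (g : graph n p N) : graph_data n p N :=
  ([ffun v => omap s (out g (s^-1%g v))], [ffun i => s (root g i)],
   [ffun i => s (covertex g i)]).

Lemma relabel_subproof n p s (g : graph n p N) : graph_axiom (relabel s g).
Proof.
apply/and3P; split=> /=.
- by apply/injectiveP => i j; rewrite !ffunE => /perm_inj/root_inj.
- apply/forallP => v; apply/eqP; rewrite ffunE.
  apply/eqP/codomP => [|[i ->]]; last by rewrite ffunE permK out_root.
  case out_v: (out g _) => //= _; have [i def_v] := (out_rootP _ _).1 out_v.
  by exists i; rewrite ffunE -def_v permKV.
- by apply/injectiveP => i j; rewrite !ffunE => /perm_inj/covertex_inj.
Qed.

Definition relabel_graph n p s (g : graph n p N) := Graph (relabel_subproof s g).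

Lemma out_relabel n p s (g : graph n p N) v :
  out (relabel_graph s g) (s v) = omap s (out g v).
Proof. by rewrite /out /= ffunE permK. Qed.

Lemma relabel_iso n p s (g : graph n p N) : graph_iso g (relabel_graph s g).
Proof.
apply/existsP; exists s; apply/and3P; split; apply/forallP => v.
- by rewrite out_relabel.
- by rewrite /root /= ffunE.
- by rewrite /covertex /= ffunE.
Qed.

Lemma graph00_eq (g h : graph 0 0 N) : out g = out h -> g = h.
Proof.
by move=> eq_out; apply: graph_eq => //; apply/ffunP => -[].
Qed.

Lemma out00 (g : graph 0 0 N) v : out g v <> None.
Proof. by move=> /out_rootP[[]]. Qed.

Lemma graph_iso00 (g h : graph 0 0 N) (s : {perm 'I_N}) :
  (forall v, out h (s v) = omap s (out g v)) -> graph_iso g h.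
Proof.
move=> so; apply/existsP; exists s; apply/and3P; split; apply/forallP; last 2 first.
- by case.
- by case.
by move=> v; apply/eqP/so.
Qed.

Lemma relabel_inj s : injective (@relabel_graph 0 0 s).
Proof.
move=> g h eq_gh; apply/graph00_eq/ffunP => v.
have : out (relabel_graph s g) (s v) = out (relabel_graph s h) (s v) by rewrite eq_gh.
by rewrite !out_relabel; case: (out g v) => [w|]; case: (out h v) => [w'|] //= [/perm_inj->].
Qed.

Definition nloops (g : graph 0 0 N) : nat := #|[set v | out g v == Some v]|.

Lemma nloops_iso g h : graph_iso g h -> nloops g = nloops h.
Proof.
move=> /graph_isoP[f [[bf fo _] _]]; have [f' fK f'K] := bf.
rewrite /nloops -!sum1_card [RHS](reindex f) /=; last by exists f' => v _.
apply: eq_bigl => v; rewrite !inE [out h _]fo /=.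
case: (out g v) => //= w; apply/eqP/eqP => -[].
  by move=> ->.
by move=> /(can_inj fK) ->.
Qed.

Lemma has_1loopE (g : graph 0 0 N) : has_1loop g = (0 < nloops g)%N.
Proof.
apply/existsP/card_gt0P => -[v]; first by exists v; rewrite inE.
by rewrite inE; exists v.
Qed.

(** Stated as a relation between graphs: since the targets [g'] are graphs
    without roots, redirecting a 1-loop to another node amounts to not keeping
    it. *)
Definition unloops (g g' : graph 0 0 N) : bool :=
  [forall v, if out g v == Some v then out g' v != Some v
             else out g' v == out g v].

Definition unloop_graph (g : graph 0 0 N) : space0 :=
  (-1) ^+ nloops g *: \sum_(g' | unloops g g') basis_vec R (\pi_(forest 0 0 N) g').

Lemma unloops_relabel (g h g' : graph 0 0 N) (s : {perm 'I_N}) :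
  (forall v, out h (s v) = omap s (out g v)) ->
  unloops h (relabel_graph s g') = unloops g g'.
Proof.
move=> so; apply/forallP/forallP => H v.
  have := H (s v); rewrite so out_relabel.
  case: (out g v) => [w|]; case: (out g' v) => [w'|] //=;
  by rewrite ?(inj_eq (@Some_inj _)) ?(inj_eq perm_inj).
rewrite -(permKV s v) so out_relabel; have := H (s^-1%g v).
case: (out g _) => [w|]; case: (out g' _) => [w'|] //=;
by rewrite ?(inj_eq (@Some_inj _)) ?(inj_eq perm_inj).
Qed.

Lemma unloop_graph_iso (g h : graph 0 0 N) :
  graph_iso g h -> unloop_graph g = unloop_graph h.
Proof.
move=> gh; rewrite /unloop_graph (nloops_iso gh); congr (_ *: _).
have /existsP[s /and3P[/forallP so _ _]] := gh.
rewrite [RHS](reindex_inj (@relabel_inj s)) /=; apply: eq_big => g'.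
  by rewrite (@unloops_relabel g) // => v; apply/eqP.
by move=> _; congr basis_vec; apply/pi_isoP/relabel_iso.
Qed.

(** Reading a 1-loop as a divergence, this is integration by parts applied to
    all the divergences of an aromatic forest simultaneously. *)
Definition unloop : 'End(space0) :=
  lin_ext (fun x : forest 0 0 N => unloop_graph (repr x)).

Lemma unloop_basis g :
  unloop (basis_vec R (\pi_(forest 0 0 N) g)) = unloop_graph g.
Proof. by rewrite lin_ext_basis; apply/unloop_graph_iso/repr_iso. Qed.

Lemma unloops_loopless (g g' : graph 0 0 N) :
  nloops g = 0%N -> unloops g g' = (g' == g).
Proof.
move=> g0; have nl v : (out g v == Some v) = false.
  by apply/negbTE/negP => vv; have : (0 < nloops g)%N;
    [apply/card_gt0P; exists v; rewrite inE|rewrite g0].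
apply/forallP/eqP => [H|-> v]; last by rewrite nl.
by apply/graph00_eq/ffunP => v; have := H v; rewrite nl => /eqP.
Qed.

Lemma unloop_graph_loopless g :
  nloops g = 0%N -> unloop_graph g = basis_vec R (\pi_(forest 0 0 N) g).
Proof.
move=> g0; rewrite /unloop_graph g0 expr0 scale1r (big_pred1 g) // => g'.
exact: unloops_loopless.
Qed.

Lemma out_add_root_edge (g : graph 1 0 N) u v :
  out (add_root_edge g u) v = if v == root g ord0 then Some u else out g v.
Proof. by rewrite /out /= ffunE. Qed.

Lemma nloops_add_root_edge (g : graph 1 0 N) u :
  nloops (add_root_edge g u) =
  ((u == root g ord0) + #|[set v | out g v == Some v]|)%N.
Proof.
set r := root g ord0; set A := [set v | _].
have r_notin : r \notin A by rewrite inE out_root.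
rewrite /nloops; have [->|neq_ur] := eqVneq u r.
  rewrite (_ : [set v | _] = r |: A) ?cardsU1 ?r_notin //.
  apply/setP => v; rewrite !inE out_add_root_edge -/r.
  by have [->|] := eqVneq v r; rewrite ?eqxx.
congr #|pred_of_set _|; apply/setP => v; rewrite !inE out_add_root_edge -/r.
have [->|//] := eqVneq v r.
by rewrite out_root; apply/negbTE/eqP => -[eq_ur]; rewrite eq_ur eqxx in neq_ur.
Qed.

(** A redirection of the 1-loops created by the edge [(r, r)] chooses a node
    [u] different from [r] as the target of [r]. *)
Lemma unloops_add_root_edge (g : graph 1 0 N) (g' : graph 0 0 N) u :
    u != root g ord0 ->
  unloops (add_root_edge g (root g ord0)) g' && (out g' (root g ord0) == Some u)
  = unloops (add_root_edge g u) g'.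
Proof.
set r := root g ord0 => neq_ur.
apply/andP/forallP => [[/forallP H /eqP out_r] v|H].
  have := H v; rewrite !out_add_root_edge -/r; have [->|//] := eqVneq v r.
  rewrite out_r (inj_eq (@Some_inj _)) eqxx => _.
  by rewrite (inj_eq (@Some_inj _)) (negPf neq_ur).
have /eqP out_r : out g' r == Some u.
  have := H r; rewrite out_add_root_edge -/r eqxx.
  by rewrite (inj_eq (@Some_inj _)) (negPf neq_ur).
split; last exact/eqP.
apply/forallP => v; have := H v; rewrite !out_add_root_edge -/r.
have [->|//] := eqVneq v r.
by rewrite eqxx out_r (inj_eq (@Some_inj _)) neq_ur.
Qed.

(** The redirections of the term with the edge [(r, r)] are shared among the
    terms with an edge [(r, u)], [u] different from [r]; these have one 1-loop
    less, hence the opposite sign. *)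
Lemma unloop_dH w : unloop (dH R N w) = 0.
Proof.
rewrite /dH lin_extE linear_sum big1 // => x _.
rewrite linearZ /= linear_sum /= (_ : \sum_i _ = 0) ?scaler0 //.
set g := repr x; set r := root g ord0.
under eq_bigr do rewrite unloop_basis.
rewrite (bigD1 r) //= {1}/unloop_graph nloops_add_root_edge eqxx add1n exprS.
rewrite mulN1r scaleNr; set l := #|_|; apply/eqP; rewrite addrC subr_eq0; apply/eqP.
(* The redirected target of [r] sorts the redirections of the first term. *)
rewrite (partition_big (fun g' => odflt r (out g' r)) (fun u => u != r)) /=.
  rewrite scaler_sumr; apply: eq_bigr => u neq_ur.
  rewrite /unloop_graph nloops_add_root_edge (negPf neq_ur) add0n -/l.
  congr (_ *: _); apply: eq_bigl => g'; rewrite -unloops_add_root_edge //.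
  by have := @out00 g' r; rewrite -/r; case: (out g' r) => // v _.
move=> g' /forallP/(_ r); rewrite out_add_root_edge -/r !eqxx.
by have := @out00 g' r; case: (out g' r) => // v _; apply: contraNneq => ->.
Qed.

Lemma add_root_edge_iso (g h : graph 1 0 N) : graph_iso g h ->
  \sum_u basis_vec R (\pi_(forest 0 0 N) (add_root_edge g u)) =
  \sum_u basis_vec R (\pi_(forest 0 0 N) (add_root_edge h u)).
Proof.
move=> /existsP[s /and3P[/forallP so /forallP sr _]].
rewrite [RHS](reindex_inj (@perm_inj _ s)) /=; apply: eq_bigr => u _.
congr basis_vec; apply/pi_isoP/(graph_iso00 (s := s)) => v.
rewrite !out_add_root_edge (eqP (sr ord0)) (inj_eq perm_inj).
by case: eqP => // _; apply/eqP.
Qed.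

Lemma dH_basis g : dH R N (basis_vec R (\pi_(forest 1 0 N) g)) =
  \sum_u basis_vec R (\pi_(forest 0 0 N) (add_root_edge g u)).
Proof. by rewrite lin_ext_basis; apply/add_root_edge_iso/repr_iso. Qed.

Lemma remove_loop_subproof (g : graph 0 0 N) v :
  graph_axiom ([ffun u => if u == v then None else out g u],
    [ffun _ : 'I_1 => v], [ffun _ : 'I_0 => v]).
Proof.
apply/and3P; split=> /=.
- by apply/injectiveP => i j; rewrite [i]ord1 [j]ord1.
- apply/forallP => u; rewrite ffunE; apply/eqP; apply/eqP/codomP => [|[i ->]].
    case: eqP => [-> _|_ /out00//]; by exists ord0; rewrite ffunE.
  by rewrite ffunE eqxx.
- by apply/injectiveP => -[].
Qed.

Definition remove_loop g v : graph 1 0 N := Graph (remove_loop_subproof g v).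

Definition loopless : seq (forest 0 0 N) :=
  enum [set x : forest 0 0 N | ~~ has_1loop (repr x)].

Lemma nloops_repr (g : graph 0 0 N) :
  nloops (repr (\pi_(forest 0 0 N) g)) = nloops g.
Proof. exact/nloops_iso/repr_iso. Qed.

(** A forest with a 1-loop at [v] is the term [u = v] of the image under [dH]
    of the forest obtained by removing this loop; the other terms have one
    1-loop less. *)
Lemma loopless_generate (x : forest 0 0 N) :
  basis_vec R x \in (limg (dH R N) + <<map (@basis_vec R 0 0 N) loopless>>)%VS.
Proof.
move: {2}(nloops _) (erefl (nloops (repr x))) => m.
elim: m x => [|m IH] x x_loops.
  apply: subvP (addvSr _ _) _ _; apply/memv_span/map_f.
  by rewrite mem_enum inE has_1loopE x_loops.
set g := repr x in x_loops.
have /card_gt0P[v] : (0 < nloops g)%N by rewrite x_loops.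
rewrite inE => /eqP vv; pose h := remove_loop g v.
have rh : root h ord0 = v by rewrite /root /= ffunE.
have hg : add_root_edge h v = g.
  apply/graph00_eq/ffunP => u; rewrite out_add_root_edge rh /out /= ffunE -/(out g u).
  by case: eqVneq => // ->.
have := dH_basis h; rewrite (bigD1 v) //= hg reprK => /eqP.
rewrite -subr_eq => /eqP <-; rewrite memvB //.
  by apply: subvP (addvSl _ _) _ _; apply/memv_img/memvf.
apply: memv_suml => u neq_uv; apply: IH; rewrite nloops_repr.
have := x_loops; rewrite -hg !nloops_add_root_edge rh eqxx (negPf neq_uv).
by rewrite add1n add0n => -[].
Qed.

Lemma dim_loopless : \dim <<map (@basis_vec R 0 0 N) loopless>> = size loopless.
Proof.
apply: dim_span_diag; first exact: enum_uniq.
  by move=> x _; rewrite ffunE eqxx oner_eq0.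
by move=> x y _ _ neq_xy; rewrite ffunE eq_sym (negPf neq_xy).
Qed.

Lemma dim_Omega_circ :
  (\dim (Omega_circ R N) + size loopless)%N = #|{: forest 0 0 N}|.
Proof.
rewrite /Omega_circ dim_span_diag ?enum_uniq //; first last.
- by move=> x y _ _ neq_xy; rewrite ffunE eq_sym (negPf neq_xy).
- by move=> x _; rewrite ffunE eqxx oner_eq0.
rewrite /loopless -!cardE -(cardsC [set x : forest 0 0 N | has_1loop (repr x)]).
by congr (_ + _)%N; apply: eq_card => x; rewrite !inE.
Qed.

(** The upper bound holds because the image is in the kernel of [unloop], whose
    image contains the forests without 1-loop; the lower bound holds because
    the image and the forests without 1-loop span everything. *)
Lemma dim_limg_dH : \dim (limg (dH R N)) = \dim (Omega_circ R N).
Proof.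
apply/eqP; rewrite -(eqn_add2r (size loopless)) dim_Omega_circ.
rewrite -(dim_forest_space 0 0 N) eqn_leq; apply/andP; split.
  rewrite -(limg_ker_dim unloop fullv) capfv leq_add //.
    apply: dimvS; apply/subvP => _ /memv_imgP[w _ ->].
    by rewrite memv_ker unloop_dH.
  rewrite -dim_loopless; apply: dimvS; apply/span_subvP => _ /mapP[x + ->].
  rewrite mem_enum inE has_1loopE -leqNgt leqn0 => /eqP x0.
  rewrite -[basis_vec R x]/(basis_vec R x) -[x]reprK -(unloop_graph_loopless x0).
  by rewrite -unloop_basis; apply/memv_img/memvf.
rewrite -dim_loopless; apply: leq_trans (dimv_add_leqif _ _).
apply: dimvS; apply/subvP => w _; rewrite [w]forest_space_basis.
apply: memv_suml => x _; apply/memvZ/loopless_generate.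
Qed.

Lemma dim_Psi :
  (\dim (Psi R N) + \dim (Omega_circ R N))%N = \dim (Omega R 1 0 N).
Proof.
rewrite /Psi !Omega_small // capvf -dim_limg_dH.
by rewrite -(limg_ker_dim (dH R N) fullv) capfv.
Qed.

End Solenoidal.

(** * Functional forms of type 1 *)

Section FunctionalForms.
Variable N : nat.

Definition leaf_covertex (g : graph 0 1 N) : bool :=
  [forall v, out g v != Some (covertex g ord0)].

Lemma leaf_covertex_iso g h :
  graph_iso g h -> leaf_covertex g -> leaf_covertex h.
Proof.
move=> /graph_isoP[f [[[f' fK f'K] fo fm] _]] /forallP g_leaf.
apply/forallP => v; rewrite -(f'K v) [out h _]fo -[covertex h _]fm /=.
have := g_leaf (f' v); case: (out g _) => //= w; apply: contraNneq => -[].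
by move/(can_inj fK) => ->.
Qed.

Definition leaf_forests : seq (forest 0 1 N) :=
  enum [set x : forest 0 1 N | leaf_covertex (repr x)].

Lemma leaf_predecessors (g : graph 0 1 N) :
  leaf_covertex g -> predecessors g (covertex g ord0) = set0.
Proof.
move=> /forallP g_leaf; apply/setP => v; rewrite !inE.
exact/negbTE/g_leaf.
Qed.

Lemma redirect_leaf (g : graph 0 1 N) f :
  f \in pffun_on (covertex g ord0) (predecessors g (covertex g ord0))
                 (predC1 (covertex g ord0)) ->
  leaf_covertex (redirect g f).
Proof.
move=> /pffun_onP[_ f_neq]; apply/forallP => v; rewrite /out /= ffunE.
rewrite -[covertex (redirect g f) ord0]/(covertex g ord0).
case: ifP => [v_pred|]; last by rewrite inE => /negbT.
apply/eqP => -[fv]; have : f v \in predC1 (covertex g ord0) by apply: f_neq; apply/imageP; exists v.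
by rewrite inE fv eqxx.
Qed.

Lemma functional_sum_leaf (x : forest 0 1 N) :
  leaf_covertex (repr x) -> functional_sum R x = basis_vec R x.
Proof.
move=> x_leaf; rewrite /functional_sum leaf_predecessors // cards0 expr0 scale1r.
set c := covertex _ _.
rewrite (big_pred1 [ffun=> c]) => [|f].
  congr basis_vec; rewrite -[RHS]reprK; congr (\pi_(forest 0 1 N) _).
  apply: graph_eq => //; apply/ffunP => v.
  by rewrite /out /= ffunE leaf_predecessors // inE.
apply/pffun_onP/eqP => [[/subsetP f_supp _]|->].
  apply/ffunP => v; rewrite ffunE; apply/eqP; apply: contraTT isT => fv.
  by have := f_supp v; rewrite !inE => /(_ fv).
split; first by apply/subsetP => v; rewrite !inE ffunE eqxx.
by move=> v /imageP[w]; rewrite inE.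
Qed.

(** The redirected predecessors avoid the covertex, and there is only one way
    to redirect an empty set of predecessors. *)
Lemma dim_I1 : \dim (I1 R N) = size leaf_forests.
Proof.
rewrite /I1 Omega_small // limg_lin_ext.
rewrite -(dim_span_diag (b := @basis_vec R 0 1 N)); first last.
- by move=> x y _ _ neq_xy; rewrite ffunE eq_sym (negPf neq_xy).
- by move=> x _; rewrite ffunE eqxx oner_eq0.
- exact: enum_uniq.
congr (\dim _); apply: subv_anti; apply/andP; split; apply/span_subvP => w.
  move=> /codomP[x ->]; apply/memvZ/memv_suml => f /redirect_leaf f_leaf.
  apply/memv_span/map_f; rewrite mem_enum inE.
  by apply: leaf_covertex_iso f_leaf; rewrite graph_iso_sym; apply: repr_iso.
move=> /mapP[x /[!mem_enum] /[!inE] x_leaf ->].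
by rewrite -functional_sum_leaf //; apply/memv_span/codom_f.
Qed.

End FunctionalForms.

Lemma dim_I1_rec N : \dim (I1 R N.+1) = pointed_forest_count 0 N.
Proof.
rewrite dim_I1 -cardE -num_classes_leaf_covertex.
rewrite (@card_forest 0 1 N.+1 _ _ _ (fun V (x : struct 'I_1 V) =>
   forall v, x.1 v <> Some (x.2 ord0))) //.
- apply: eq_num_classes => V x; split=> [[x0 xl]|[[x0 _] xl]]; split=> //.
  by split=> //; apply: rigid_small; rewrite x0.
- move=> V W x y [f [[g fK gK] fo fm]] xl w.
  rewrite -(gK w) fo -fm; case out_g: (x.1 (g w)) => [v|] //= -[/(can_inj fK) eq_v].
  by apply: (xl (g w)); rewrite out_g eq_v.
- move=> x; split=> [/forallP x_leaf v|x_leaf]; first exact/eqP.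
  by apply/forallP => v; apply/eqP/x_leaf.
Qed.

End Dimensions.

(** * Formal power series and the operator z d/dz *)

Section FpsBasics.
Variable A : comNzRingType.
Implicit Types (f g h : fps A) (c : A) (n m : nat).

Lemma coefs1 n : (1 : fps A) n = (n == 0%N)%:R.
Proof. by rewrite [LHS]/=; case: eqP. Qed.

Lemma coefsD f g n : (f + g) n = f n + g n. Proof. by []. Qed.
Lemma coefsN f n : (- f) n = - f n. Proof. by []. Qed.
Lemma coefsM f g n : (f * g) n = \sum_(i < n.+1) f i * g (n - i)%N.
Proof. by []. Qed.

Lemma coefsMn f m n : (f *+ m) n = f n *+ m.
Proof. by elim: m => // m IH; rewrite !mulrS coefsD IH. Qed.

Lemma coefs_sum (I : Type) (r : seq I) (P : pred I) (F : I -> fps A) n :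
  (\sum_(i <- r | P i) F i) n = \sum_(i <- r | P i) F i n.
Proof. by elim/big_rec2: _ => // i x y _ <-. Qed.

Lemma fpsCM c f n : (fpsC c * f) n = c * f n.
Proof.
rewrite coefsM big_ord_recl /= subn0 big1 ?addr0 // => i _.
by rewrite mul0r.
Qed.

Lemma fpsC_exp c k : fpsC c ^+ k = fpsC (c ^+ k).
Proof.
elim: k => [|k IH]; first by apply: fpsP => n /=.
rewrite !exprS IH; apply: fpsP => n; rewrite fpsCM /=.
by case: eqP => // _; rewrite mulr0.
Qed.

Lemma fpsX_expE k n : (fpsX ^+ k : fps A) n = (n == k)%:R.
Proof.
elim: k n => [|k IH] n; first by rewrite expr0 coefs1.
rewrite exprS coefsM; case: n => [|n].
  by rewrite big_ord1 /= mul0r.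
rewrite big_ord_recl /= mul0r add0r big_ord_recl /= mul1r /bump /= subn1 IH.
by rewrite big1 ?addr0 //= => i _; rewrite mul0r.
Qed.

Lemma fpsXM f n : (fpsX * f) n = if n is m.+1 then f m else 0.
Proof.
rewrite coefsM; case: n => [|n]; first by rewrite big_ord1 /= mul0r.
rewrite big_ord_recl /= mul0r add0r big_ord_recl /= mul1r /bump /= subn1.
by rewrite big1 ?addr0 //= => i _; rewrite mul0r.
Qed.

Lemma fps_natr_unit m (c : A) : c * m%:R = 1 -> (m%:R : fps A) \is a GRing.unit.
Proof.
move=> cm; apply/asboolP; exists (fpsC c); apply: fpsP => n.
rewrite fpsCM coefsMn coefs1; case: eqP => // _; first by rewrite mul0rn mulr0.
Qed.

(** The multiples of the [m]-th power of the variable. *)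
Definition vanish m f := forall n, (n < m)%N -> f n = 0.

Lemma vanishM a b f g : vanish a f -> vanish b g -> vanish (a + b) (f * g).
Proof.
move=> fa gb n lt_n; rewrite coefsM big1 // => i _.
have [lt_ia|le_ai] := ltnP i a; first by rewrite fa ?mul0r.
by rewrite gb ?mulr0 //; have := ltn_ord i; lia.
Qed.

Lemma vanish0 f : vanish 0 f. Proof. by []. Qed.

Lemma vanishX f m : f 0%N = 0 -> vanish m (f ^+ m).
Proof.
move=> f0; elim: m => [|m IH]; first exact: vanish0.
rewrite exprS; apply: (@vanishM 1) => // n.
by case: n.
Qed.

(** The inverse is the geometric series. *)
Lemma fps_unit1B f : f 0%N = 0 -> (1 - f) \is a GRing.unit.
Proof.
move=> f0; apply/asboolP; exists (fps_sum 0 (fun k => f ^+ k)).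
apply: fpsP => n; rewrite mulrC.
have geo : ((1 - f) * fps_sum 0 (fun k => f ^+ k)) n
    = ((1 - f) * \sum_(0 <= k < n.+1) f ^+ k) n.
  rewrite !coefsM; apply: eq_bigr => i _; congr (_ * _).
  rewrite coefs_sum /= [RHS](big_cat_nat _ (n := (n - i).+1)) //=; last first.
    by rewrite ltnS leq_subr.
  rewrite [X in _ = _ + X]big1_seq ?addr0 // => k /andP[_].
  by rewrite mem_index_iota => /andP[lt_k _]; apply: (vanishX f0).
rewrite geo big_mkord -[1 - f]opprB mulNr -subrX1 opprB coefsD coefsN.
by rewrite (vanishX f0) // subr0.
Qed.

(** The derivation [z d/dz], which preserves the degrees. *)
Definition theta f : fps A := Fps (fun n => f n *+ n).

Lemma theta0 f : theta f 0%N = 0. Proof. exact: mulr0n. Qed.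

Lemma thetaD f g : theta (f + g) = theta f + theta g.
Proof. by apply: fpsP => n; rewrite /= mulrnDl. Qed.

Lemma thetaN f : theta (- f) = - theta f.
Proof. by apply: fpsP => n; rewrite /= mulNrn. Qed.

Lemma theta_sum (I : Type) (r : seq I) (P : pred I) (F : I -> fps A) :
  theta (\sum_(i <- r | P i) F i) = \sum_(i <- r | P i) theta (F i).
Proof.
apply: (big_morph theta thetaD); apply: fpsP => n; exact: mul0rn.
Qed.

Lemma thetaM f g : theta (f * g) = theta f * g + f * theta g.
Proof.
apply: fpsP => n; rewrite coefsD !coefsM /= -sumrMnl -big_split /=.
apply: eq_bigr => i _; rewrite mulrnAl mulrnAr -mulrnDr.
by rewrite subnKC // -ltnS.
Qed.

Lemma theta_fpsC c : theta (fpsC c) = 0.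
Proof. by apply: fpsP => -[|n] /=; rewrite ?mulr0n ?mul0rn. Qed.

Lemma thetaMn f m : theta (f *+ m) = theta f *+ m.
Proof. by apply: fpsP => n; rewrite coefsMn /= coefsMn mulrnAC. Qed.

Lemma theta1 : theta 1 = 0. Proof. exact: theta_fpsC. Qed.

Lemma theta_exp f m : theta (f ^+ m) = f ^+ m.-1 * theta f *+ m.
Proof.
elim: m => [|m IH]; first by rewrite theta1 mulr0n.
rewrite exprS thetaM IH mulrnAr mulrA -exprS mulrC mulrS; congr (_ + _).
by case: m {IH} => [|m]; rewrite ?mulr0n // -exprS.
Qed.

Lemma theta_natrV m :
  (m%:R : fps A) \is a GRing.unit -> theta (m%:R^-1) = 0.
Proof.
move=> mU; apply: (mulrI mU); rewrite mulr0.
have := thetaM m%:R m%:R^-1; rewrite divrr // theta1 thetaMn theta1 mul0rn.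
by rewrite mul0r add0r.
Qed.

(** The equation is read as a recursion: the coefficient of degree [n] in [g
    f1] involves only the coefficients of [g] of degree less than [n], as [f1]
    has no constant term. *)
Lemma theta_ode_unique (f1 f2 g1 g2 : fps A) n :
    (forall k (x : A), x *+ k.+1 = 0 -> x = 0) ->
    theta g1 = g1 * f1 -> theta g2 = g2 * f2 -> g1 0%N = g2 0%N ->
    f1 0%N = 0 -> f2 0%N = 0 ->
    (forall k, (k <= n)%N -> f1 k = f2 k) ->
  forall k, (k <= n)%N -> g1 k = g2 k.
Proof.
move=> nat_reg ode1 ode2 g0 f10 f20 f12; elim/ltn_ind => -[//|k] IH lt_kn.
apply/eqP; rewrite -subr_eq0; apply/eqP/(nat_reg k); apply/eqP.
rewrite mulrnBl -[_ *+ _]/(theta g1 k.+1) -[X in _ - X]/(theta g2 k.+1).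
rewrite ode1 ode2 subr_eq0 !coefsM 2!(big_ord_recr k.+1) /= subnn f10 f20 !mulr0.
apply/eqP; congr (_ + _); apply: eq_bigr => i _.
by rewrite IH ?f12 //; have := ltn_ord i; lia.
Qed.

(** The infinite sum is replaced by its partial sums [E M], which agree with it
    in degrees less than [M]. *)
Lemma theta_fps_exp f :
    (forall m, (m.+1%:R : fps A) \is a GRing.unit) -> f 0%N = 0 ->
  theta (fps_exp f) = fps_exp f * theta f.
Proof.
move=> natU f0.
have factU m : (m`!%:R : fps A) \is a GRing.unit.
  by rewrite -(prednK (fact_gt0 m)).
pose E M := \sum_(m < M) f ^+ m / m`!%:R.
have expE M n : (n < M)%N -> fps_exp f n = E M n.
  move=> lt_nM; rewrite /E coefs_sum /= -(big_mkord xpredT (fun m => (f ^+ m / m`!%:R) n)).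
  rewrite [RHS](big_cat_nat _ (n := n.+1)) //=.
  rewrite [X in _ = _ + X]big1_seq ?addr0 // => k /andP[_].
  rewrite mem_index_iota => /andP[lt_k _].
  by apply: (vanishM (vanishX (m := k) f0) (@vanish0 _)); rewrite addn0.
have thetaE M : theta (E M.+1) = E M * theta f.
  rewrite /E theta_sum big_ord_recl /= expr0 mul1r theta_natrV // add0r.
  rewrite mulr_suml; apply: eq_bigr => m _.
  rewrite thetaM theta_exp theta_natrV // mulr0 addr0.
  have -> : (m.+1`!%:R : fps A)^-1 = m.+1%:R^-1 / m`!%:R.
    by rewrite factS natrM invrM // mulrC.
  rewrite -mulr_natr -!mulrA; congr (_ * _).
  by rewrite [m.+1%:R * _]mulrA divrr // mul1r mulrC.
apply: fpsP => n.
rewrite -[LHS]/(fps_exp f n *+ n) (expE n.+2) //.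
rewrite -[LHS]/(theta (E n.+2) n) thetaE !coefsM; apply: eq_bigr => i _.
by rewrite (expE n.+1).
Qed.

End FpsBasics.

Lemma fpsX_expM (A : comNzRingType) (f : fps A) m n :
  (fpsX ^+ m * f) n = if (m <= n)%N then f (n - m)%N else 0.
Proof.
elim: m n => [|m IH] n; first by rewrite mul1r subn0.
by rewrite exprS -mulrA fpsXM; case: n => [|n] //; rewrite IH.
Qed.

(** Double sums over [m k = N] are used to exchange a divisor of [N] with its
    cofactor. *)
Lemma sum_mul_eq (V : nmodType) (h : nat -> V) n N k :
    (0 < k)%N -> (0 < N <= n)%N ->
  \sum_(1 <= m < n.+1) (if (m * k == N)%N then h m else 0)
    = if (k %| N)%N then h (N %/ k)%N else 0.
Proof.
move=> k0 /andP[N0 le_Nn]; case: ifPn => [/dvdnP[m def_N]|ndvd].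
  subst N.
  rewrite mulnK // -big_mkcond /= (eq_bigl (fun i => i == m)).
    move: N0 le_Nn; rewrite muln_gt0 big_nat1_eq => /andP[-> _] le_mk.
    by rewrite ltnS (leq_trans _ le_mk) // leq_pmulr.
  by move=> i; rewrite eqn_pmul2r.
rewrite big1_seq // => m _; case: eqP => // mk.
by rewrite -mk dvdn_mull in ndvd.
Qed.

Lemma signM (A : comNzRingType) k (f : fps A) N :
  ((-1) ^+ k * f) N = (-1) ^+ k * f N.
Proof.
by rewrite -signr_odd -(signr_odd A); case: odd; rewrite ?mulN1r ?mul1r.
Qed.

Lemma bifps_natr_unit m : (m.+1%:R : bifps) \is a GRing.unit.
Proof.
have cK : fpsC (m.+1%:R^-1 : rat) * m.+1%:R = 1.
  apply: fpsP => n; rewrite fpsCM coefsMn coefs1.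
  by case: n => [|n]; rewrite ?mul0rn ?mulr0 // mulVf // pnatr_eq0.
exact: fps_natr_unit cK.
Qed.

Lemma fps_rat_mulIn k (x : fps rat) : x *+ k.+1 = 0 -> x = 0.
Proof.
move=> xk; apply: fpsP => n; apply/eqP.
have /eqP : (x *+ k.+1) n = 0 by rewrite xk.
by rewrite coefsMn mulrn_eq0.
Qed.

(** * The product over all trees as an exponential *)

Section TreeSeries.
Variables (B : comNzRingType) (u : B).
Hypothesis natU : forall m, (m.+1%:R : fps B) \is a GRing.unit.
Hypothesis natI : forall k (x : B), x *+ k.+1 = 0 -> x = 0.
Variable T : nat -> nat.
Let t : fps B := gf B T.
Let bi_u : fps B := fpsC u.

Let bi_u_expM k (f : fps B) N : (bi_u ^+ k * f) N = u ^+ k * f N.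
Proof. by rewrite /bi_u fpsC_exp fpsCM. Qed.

Definition polya_log : fps B :=
  fps_sum 1 (fun k : nat =>
              (-1) ^+ k.-1 / k%:R * bi_u ^+ k
              * fps_substX k t).

Lemma polya_log0 : polya_log 0%N = 0.
Proof. by rewrite /= big_geq. Qed.

Lemma theta_polya_log N : theta polya_log N =
  \sum_(1 <= k < N.+1) (-1) ^+ k.-1 * u ^+ k *
     (if (k %| N)%N then (T (N %/ k)%N)%:R *+ (N %/ k) else 0).
Proof.
rewrite -[LHS]/((\sum_(1 <= k < N.+1) ((-1) ^+ k.-1 / k%:R * bi_u ^+ k
  * fps_substX k t) N) *+ N) -sumrMnl.
apply: eq_big_nat => -[|k] // /andP[_ lt_k].
set c := _ / _ * _.
have theta_c : theta c = 0.
  rewrite /c !thetaM theta_natrV ?natU // mulr0 addr0.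
  rewrite /bi_u fpsC_exp theta_fpsC mulr0 addr0 /=.
  by rewrite theta_exp thetaN theta1 oppr0 mulr0 mul0rn !mul0r.
have -> : (c * fps_substX k.+1 t) N *+ N = (c * theta (fps_substX k.+1 t)) N.
  rewrite -[LHS]/(theta (c * fps_substX k.+1 t) N).
  by rewrite thetaM theta_c mul0r add0r.
have -> : theta (fps_substX k.+1 t) = k.+1%:R * fps_substX k.+1 (theta t).
  apply: fpsP => n; rewrite mulr_natl coefsMn /=; case: ifP => [kn|_].
    by rewrite -mulrnA divnK.
  by rewrite !mul0rn.
have -> : c * (k.+1%:R * fps_substX k.+1 (theta t))
    = (-1) ^+ k * (bi_u ^+ k.+1 * fps_substX k.+1 (theta t)).
  rewrite /c !mulrA; congr (_ * _); rewrite mulrAC; congr (_ * _).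
  by rewrite divrK // natU.
rewrite signM bi_u_expM mulrA; congr (_ * _) => /=.
case: ifP => // _; case: eqP => [->|//].
by rewrite !mulr0n.
Qed.

Definition tree_factor m : fps B := 1 + bi_u * fpsX ^+ m.

(** The series [m u z^m / (1 + u z^m)], that is [theta g / g] for [g = 1 + u
    z^m]. *)
Definition tree_dlog m : fps B := Fps (fun N =>
  if (m %| N)%N && (0 < N)%N then (-1) ^+ (N %/ m).-1 * u ^+ (N %/ m) *+ m
  else 0).

Lemma tree_dlogE m N : tree_dlog m N =
  if (m %| N)%N && (0 < N)%N then (-1) ^+ (N %/ m).-1 * u ^+ (N %/ m) *+ m
  else 0.
Proof. by []. Qed.

(** Expanding [(1 + u z^m)] times the series [tree_dlog m], the terms cancel in
    pairs except the first one. *)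
Lemma theta_tree_factor m : (0 < m)%N ->
  theta (tree_factor m) = tree_factor m * tree_dlog m.
Proof.
move=> m0; rewrite /tree_factor thetaD theta1 add0r mulrDl mul1r -mulrA.
apply: fpsP => N; rewrite coefsD (bi_u_expM 1) fpsX_expM expr1.
rewrite -[LHS]/((bi_u * fpsX ^+ m) N *+ N) (bi_u_expM 1) fpsX_expE expr1 !tree_dlogE.
have [->|neq_Nm] := eqVneq N m.
  by rewrite dvdnn divnn m0 leqnn subnn ltnn andbF andbT mulr0 addr0 !mul1r mulr1.
rewrite mulr0 mul0rn; have [lt_Nm|le_mN] := ltnP N m.
  case: N lt_Nm {neq_Nm} => [|N] lt_Nm; first by rewrite andbF mulr0 addr0.
  by rewrite gtnNdvd //= mulr0 addr0.
have lt_mN : (m < N)%N by rewrite ltn_neqAle eq_sym neq_Nm.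
rewrite subn_gt0 lt_mN (leq_trans m0 le_mN) !andbT dvdn_subl //.
case: ifP => [/dvdnP[q def_N]|_]; last by rewrite mulr0 addr0.
have -> : ((N - m) %/ m = q.-1)%N.
  by rewrite def_N -{2}(mul1n m) -mulnBl mulnK // subn1.
have -> : (N %/ m = q)%N by rewrite def_N mulnK.
case: q def_N => [|[|q]] def_N.
- by rewrite def_N mul0n in lt_mN.
- by rewrite def_N mul1n ltnn in lt_mN.
by rewrite -pred_Sn exprS mulN1r mulNr mulNrn mulrnAr [u * (_ * _)]mulrCA -exprS addNr.
Qed.

Definition tree_prod n : fps B :=
  \prod_(1 <= m < n.+1) tree_factor m ^+ T m.

Definition tree_prod_dlog n : fps B :=
  \sum_(1 <= m < n.+1) tree_dlog m *+ T m.

Lemma theta_tree_prod n :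
  theta (tree_prod n) = tree_prod n * tree_prod_dlog n.
Proof.
elim: n => [|n IH].
  by rewrite /tree_prod /tree_prod_dlog !big_geq // theta1 mulr0.
rewrite /tree_prod /tree_prod_dlog !(big_nat_recr n.+1) //=.
rewrite -/(tree_prod n) -/(tree_prod_dlog n) thetaM IH theta_exp.
rewrite theta_tree_factor // mulrDr mulrAC; congr (_ + _).
case: (T n.+1) => [|k]; first by rewrite !mulr0n !mulr0.
by rewrite /= [in RHS]exprSr !mulrnAr !mulrA.
Qed.

Lemma tree_prod0 n : tree_prod n 0%N = 1.
Proof.
have mul0 (f g : fps B) : (f * g) 0%N = f 0%N * g 0%N.
  by rewrite coefsM big_ord1.
rewrite /tree_prod big_seq_cond.
elim/big_ind: _ => [//|f g f1 g1|m]; first by rewrite mul0 f1 g1 mulr1.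
rewrite mem_index_iota andbT => /andP[m0 _].
have fac0 : tree_factor m 0%N = 1.
  rewrite /tree_factor coefsD (bi_u_expM 1) fpsX_expE.
  by rewrite eq_sym gtn_eqF // mulr0 addr0.
by elim: (T m) => // k IH; rewrite exprS mul0 fac0 IH mulr1.
Qed.

(** Both sides are the sum of [(-1)^(k-1) m T m u^k] over all [k] and [m] with
    [k m = N]. *)
Lemma theta_polya_log_dlog n N : (N <= n)%N ->
  theta polya_log N = tree_prod_dlog n N.
Proof.
move=> le_Nn; rewrite theta_polya_log coefs_sum.
have [->|N0] := posnP N.
  by rewrite big_geq // big1 // => m _; rewrite coefsMn /= andbF mul0rn.
have tN k : (0 < k)%N ->
    (if (k %| N)%N then (T (N %/ k)%N)%:R *+ (N %/ k) else 0 : B)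
    = \sum_(1 <= m < n.+1) (if (m * k == N)%N then (T m)%:R *+ m else 0).
  by move=> k0; rewrite (@sum_mul_eq _ (fun m => (T m)%:R *+ m)) ?N0.
rewrite (eq_big_nat _ _ (F2 := fun k => \sum_(1 <= m < n.+1)
  (if (k * m == N)%N then
     (-1) ^+ k.-1 * u ^+ k *+ m *+ T m else 0))); last first.
  move=> k /andP[k0 _]; rewrite tN // mulr_sumr; apply: eq_bigr => m _.
  rewrite mulnC; case: ifP => _; last by rewrite mulr0.
  by rewrite mulrnAr mulr_natr mulrnAC.
rewrite exchange_big_nat /=; apply: eq_big_nat => m /andP[m0 _].
rewrite (@sum_mul_eq _ (fun k => (-1) ^+ k.-1 * u ^+ k *+ m *+ T m)) ?N0 ?leqnn //.
by rewrite coefsMn /= N0 andbT; case: ifP; rewrite ?mul0rn.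
Qed.

(** Both sides have constant term 1 and satisfy [theta g = g f] for series [f]
    which agree up to the degree [n]. *)
Lemma fps_exp_polya_log n k : (k <= n)%N ->
  fps_exp polya_log k = tree_prod n k.
Proof.
move: k; apply: (theta_ode_unique (n := n) (f1 := theta polya_log)
  (f2 := tree_prod_dlog n)) => //.
- exact: theta_fps_exp natU polya_log0.
- exact: theta_tree_prod.
- rewrite tree_prod0 -[LHS]/(\sum_(0 <= m < 1) (polya_log ^+ m / m`!%:R) 0%N).
  by rewrite big_nat1 expr0 divr1 coefs1.
- by rewrite -(@theta_polya_log_dlog n) // theta0.
- by move=> k le_kn; apply: theta_polya_log_dlog.
Qed.

End TreeSeries.

(** * Generating functions of numbers of classes *)

Section Series.

Definition count_gf (A : comNzRingType) (d : nat -> nat) : fps A :=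
  Fps (fun N => (d N)%:R).

Definition count_bigf (d : nat -> nat -> nat) : bifps :=
  Fps (fun N => Fps (fun k => (d k N)%:R)).

Lemma eq_count_bigf d d' :
  (forall k N, d k N = d' k N) -> count_bigf d = count_bigf d'.
Proof. by move=> dd'; apply: fpsP => N; apply: fpsP => k /=; rewrite dd'. Qed.

Lemma count_gfM (A : comNzRingType) (d d' : nat -> nat) :
  count_gf A (fun N => \sum_(i < N.+1) d i * d' (N - i))%N =
  count_gf A d * count_gf A d'.
Proof.
apply: fpsP => N; rewrite coefsM /= natr_sum.
by apply: eq_bigr => i _; rewrite natrM.
Qed.

Lemma count_gfD (A : comNzRingType) (d d' : nat -> nat) :
  count_gf A (fun N => d N + d' N)%N = count_gf A d + count_gf A d'.
Proof. by apply: fpsP => N; rewrite coefsD /= natrD. Qed.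

Lemma count_bigfM (d : nat -> nat) (d' : nat -> nat -> nat) :
  count_bigf (fun k N => \sum_(i < N.+1) d i * d' k (N - i))%N =
  count_gf (fps rat) d * count_bigf d'.
Proof.
apply: fpsP => N; rewrite coefsM; apply: fpsP => k; rewrite coefs_sum.
rewrite [LHS]natr_sum; apply: eq_bigr => i _.
rewrite -[count_gf _ d i]/((d i)%:R) mulr_natl coefsMn natrM mulr_natl.
by [].
Qed.

Lemma count_bigfD (d d' : nat -> nat -> nat) :
  count_bigf (fun k N => d k N + d' k N)%N = count_bigf d + count_bigf d'.
Proof. by apply: fpsP => N; apply: fpsP => k; rewrite !coefsD /= natrD. Qed.

Lemma count_bigfS (d : nat -> nat -> nat) :
  count_bigf (fun k N => if k is k'.+1 then d k' N else 0%N) =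
  bi_u * count_bigf d.
Proof.
by apply: fpsP => N; apply: fpsP => k; rewrite fpsCM fpsXM; case: k.
Qed.

Lemma count_gf_dirac (A : comNzRingType) n :
  count_gf A (fun i => i == n) = fpsX ^+ n.
Proof. by apply: fpsP => N; rewrite fpsX_expE. Qed.

End Series.

(** * Adding the trees one by one *)

Section TreeByTree.

(** The trees of the list are added one at a time; they are pairwise non
    isomorphic, so that each of them is new when it is added. *)
Lemma forest_series_add (S : struct_prop 'I_1) n (l : seq (struct 'I_1 'I_n)) :
    (forall tau, tau \in l -> rooted ord0 tau /\ ~ S _ tau) ->
    pairwise (fun x y => ~~ `[< iso x y >]) l ->
  count_bigf (fun k => num_classes (forest_in (fun V T =>
                S V T \/ exists2 tau, tau \in l & iso T tau) k)) =
  tree_factor fpsX n ^+ size l * count_bigf (fun k => num_classes (forest_in S k)).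
Proof.
elim: l => [|tau l IH] l_trees /=.
  move=> _; rewrite mul1r; apply: eq_count_bigf => k N; apply: eq_num_classes => V x.
  split=> -[xk xS]; split=> // r W T rN rT; last by left; apply: xS rN rT.
  by case: (xS r W T rN rT) => // -[].
move=> /andP[/allP tau_l l_pair].
pose S' : struct_prop 'I_1 := fun V T => S V T \/ exists2 tau, tau \in l & iso T tau.
have [tau_rooted ntau] := l_trees _ (mem_head _ _).
have ntau' : ~ S' _ tau.
  by case=> // -[tau' /tau_l /negP + tau_tau']; apply; apply/asboolP.
rewrite exprS -mulrA -IH //; last first.
  by move=> tau' tau'_l; apply: l_trees; rewrite inE tau'_l orbT.
rewrite /tree_factor mulrDl mul1r -mulrA -count_gf_dirac -count_bigfM.
rewrite -count_bigfS -count_bigfD; apply: eq_count_bigf => k N.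
rewrite -(num_classes_forest_add tau_rooted ntau').
apply: eq_num_classes => V x; split=> -[xk xS]; split=> // r W T rN rT.
  case: (xS r W T rN rT) => [ST|[tau' + T_tau']]; first by left; left.
  rewrite inE => /predU1P[<-|tau'_l]; first by right.
  by left; right; exists tau'.
case: (xS r W T rN rT) => [[ST|[tau' tau'_l T_tau']]|T_tau]; first by left.
  by right; exists tau' => //; rewrite inE tau'_l orbT.
by right; exists tau => //; apply: mem_head.
Qed.

(** The trees are bounded by [n] nodes. For [n = 0] there are no trees, hence
    no roots; for [n >= N] the bound says nothing. *)
Definition forest_upto n k N :=
  num_classes (forest_in (fun V _ => (#|V| <= n)%N) k) N.

Lemma forest_upto0 : count_bigf (forest_upto 0) = count_gf (fps rat) (forest_count 0).
Proof.
apply: fpsP => N; apply: fpsP => k; rewrite /= -[in RHS]mulr_natr.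
rewrite mulr_natr coefsMn coefs1.
case: k => [|k] /=.
  congr (_%:R); apply: eq_num_classes => V x; split=> [[]//|x0]; split=> // r W T rN _.
  case: x0 => /eqP; rewrite cards_eq0 => /eqP/setP/(_ r).
  by rewrite !inE rN.
rewrite mul0rn /forest_upto num_classes0 // => V x _ [[xk _] xS].
have /card_gt0P[r] : (0 < nroots x)%N by rewrite xk.
rewrite inE => /eqP rN; have [W [T rT]] := tree_of_exists rN.
have := xS r W T rN rT; rewrite leqn0 => /eqP/card0_eq/(_ (T.2 ord0)).
by rewrite inE.
Qed.

Lemma forest_uptoS n :
  count_bigf (forest_upto n.+1) =
  tree_factor fpsX n.+1 ^+ tree_count n.+1 * count_bigf (forest_upto n).
Proof.
pose S : struct_prop 'I_1 := fun V _ => (#|V| <= n)%N.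
have [l [size_l l_trees l_all l_pair]] :=
  nclasses_reps (@rooted 'I_1 ord0 'I_n.+1) (iso_equivalence _ _).
rewrite -[tree_count n.+1]size_l -forest_series_add //; last first.
  by move=> tau /l_trees tau_r; split=> //; rewrite /S card_ord ltnn.
apply: eq_count_bigf => k N; apply: eq_num_classes => V x.
split=> -[xk xS]; split=> // r W T rN rT; have := xS r W T rN rT.
  rewrite /S leq_eqVlt ltnS => /orP[/eqP cW|]; [right|by left].
  have [y T_y] := iso_ord T cW.
  have [tau tau_l y_tau] := l_all y (rooted_inv T_y (tree_of_rooted rN rT)).
  by exists tau => //; apply: iso_trans T_y y_tau.
by case=> [|[tau _ /iso_card ->]]; [apply: leqW|rewrite card_ord].
Qed.

Lemma forest_upto_prod n :
  count_bigf (forest_upto n) =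
  count_gf (fps rat) (forest_count 0) * tree_prod fpsX tree_count n.
Proof.
elim: n => [|n IH].
  by rewrite forest_upto0 /tree_prod big_geq // mulr1.
rewrite forest_uptoS IH /tree_prod [in RHS]big_nat_recr //= mulrCA.
by congr (_ * _); rewrite mulrC.
Qed.

Lemma forest_upto_stable n k N : (N <= n)%N -> forest_upto n k N = forest_count k N.
Proof.
move=> le_Nn; apply: eq_nclasses => x; split=> [[]//|xk]; split=> //.
move=> r W T _ [e [e_inj _ _ _]]; apply: leq_trans le_Nn.
by rewrite -[X in (_ <= X)%N](card_ord N) (leq_card e).
Qed.

Lemma forest_series_exp :
  count_bigf forest_count =
  count_gf (fps rat) (forest_count 0) * fps_exp (polya_log fpsX tree_count).
Proof.
apply: fpsP => N; transitivity (count_bigf (forest_upto N) N).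
  by apply: fpsP => k /=; rewrite forest_upto_stable.
rewrite forest_upto_prod !coefsM; apply: eq_bigr => i _; congr (_ * _).
apply/esym/fps_exp_polya_log; last exact: leq_subr.
- exact: bifps_natr_unit.
- exact: fps_rat_mulIn.
Qed.

End TreeByTree.

(** * The generating functions of the bicomplex *)

Section Final.
Variable R : realType.

Lemma num_classes_size0 (K : finType) (Q : struct_prop K) (y : struct K 'I_0) :
  (forall x, Q 'I_0 x) -> num_classes Q 0 = 1%N.
Proof.
move=> allQ; rewrite /num_classes /nclasses (_ : imset _ _ = [set class_of (@iso _ _ _) y]).
  exact: cards1.
have all_y (x : struct K 'I_0) : x = y.
  rewrite [x]surjective_pairing [y]surjective_pairing; congr pair; apply/ffunP.
    by case.
  by move=> k; case: (x.2 k).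
apply/setP => C; rewrite inE; apply/imsetP/eqP => [[x _ ->]|->].
  by rewrite (all_y x).
by exists y; rewrite // inE; apply/asboolP.
Qed.

Lemma forest_count_size0 k : forest_count k 0 = (k == 0%N).
Proof.
have noroots (x : struct 'I_0 'I_0) : nroots x = 0%N.
  by apply/eqP; rewrite cards_eq0; apply/eqP/setP => -[].
case: k => [|k].
  apply: num_classes_size0; first by split; apply: finfun; case.
  by move=> x; split=> // f _ [].
by apply: nclasses0 => x [xk _]; rewrite noroots in xk.
Qed.

Lemma marked_size0 (Q : struct_prop 'I_1) : num_classes Q 0 = 0%N.
Proof. by apply: nclasses0 => x; case: (x.2 ord0). Qed.

Lemma t_gfE (A : comNzRingType) : t_gf A = count_gf A tree_count.
Proof.
apply: fpsP => N /=; rewrite num_rooted_treesE; case: eqP => // ->.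
by rewrite /tree_count marked_size0.
Qed.

Lemma a_gfE (A : comNzRingType) : a_gf R A = count_gf A (forest_count 0).
Proof.
apply: fpsP => N; rewrite coefsD coefs1 /= dim_Omega //.
by case: eqP => [->|_]; rewrite ?add0r ?addr0 // forest_count_size0.
Qed.

Lemma b0_gfE : b0_gf R = count_bigf forest_count.
Proof.
apply: fpsP => N; apply: fpsP => k; rewrite !coefsD coefs1 /= dim_Omega //.
case: eqP => [->|_]; last by rewrite add0r.
by rewrite addr0 coefs1 forest_count_size0.
Qed.

Lemma b1_gfE : b1_gf R = count_bigf pointed_forest_count.
Proof.
apply: fpsP => N; apply: fpsP => k /=; rewrite dim_Omega //.
by case: eqP => // ->; rewrite /pointed_forest_count marked_size0.
Qed.

Lemma pointed_tree_series (A : comNzRingType) :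
  count_gf A pointed_tree_count = t_gf A / (1 - t_gf A).
Proof.
have tU : 1 - t_gf A \is a GRing.unit by apply: fps_unit1B.
apply: (mulIr tU); rewrite divrK // mulrBr mulr1; apply/eqP; rewrite subr_eq.
apply/eqP; rewrite t_gfE [_ * count_gf _ tree_count]mulrC -count_gfM -count_gfD.
by apply: fpsP => N /=; rewrite pointed_tree_rec.
Qed.

Lemma pointed_forest_series :
  count_bigf pointed_forest_count =
  bi_u * (t_gf (fps rat) * count_bigf forest_count)
  + (count_gf (fps rat) pointed_tree_count * count_bigf forest_count
     + t_gf (fps rat) * count_bigf pointed_forest_count).
Proof.
rewrite t_gfE -!count_bigfM -count_bigfS -!count_bigfD.
by apply: eq_count_bigf => k N; rewrite pointed_forest_rec.
Qed.

Lemma pointed_forest_series0 :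
  count_gf rat (pointed_forest_count 0) =
  count_gf rat pointed_tree_count * count_gf rat (forest_count 0)
  + t_gf rat * count_gf rat (pointed_forest_count 0).
Proof.
rewrite t_gfE -!count_gfM -count_gfD.
by apply: fpsP => N /=; rewrite pointed_forest_rec.
Qed.

Lemma pointed_series_solve (A : comUnitRingType) (u t B X : A) :
    1 - t \is a GRing.unit ->
    X = u * (t * B) + (t / (1 - t) * B + t * X) ->
  X = B * (t * (1 + u - u * t) / (1 - t) ^+ 2).
Proof.
move=> tU eqX; have tU2 : (1 - t) ^+ 2 \is a GRing.unit by rewrite unitrX.
have [p pE] : exists p, p = t / (1 - t) by exists (t / (1 - t)).
have pt : p * (1 - t) = t by rewrite pE divrK.
rewrite mulrA; apply: (mulIr tU2); rewrite divrK //.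
have X1 : X * (1 - t) = (u * t + p) * B.
  by apply/eqP; rewrite mulrBr mulr1 subr_eq {1}eqX -pE; apply/eqP; ring.
rewrite expr2 [X * _]mulrA X1.
have -> : (u * t + p) * B * (1 - t) = B * (u * t * (1 - t) + p * (1 - t)) by ring.
by rewrite pt; ring.
Qed.

End Final.

Theorem theorem4p2 (R : realType) :
  [/\ b0_gf R
        = a_gf R (fps rat)
          * fps_exp (fps_sum 1 (fun k : nat =>
              (-1) ^+ k.-1 / k%:R * bi_u ^+ k
              * fps_substX k (t_gf (fps rat)))),
      b1_gf R
        = b0_gf R
          * (t_gf (fps rat) * (1 + bi_u - bi_u * t_gf (fps rat))
             / (1 - t_gf (fps rat)) ^+ 2),
      c1_gf R = fpsX * bi_u0 (b1_gf R)
        /\ fpsX * bi_u0 (b1_gf R)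
           = fpsX * a_gf R rat * t_gf rat / (1 - t_gf rat) ^+ 2
    & s_gf R = a_gf R rat * t_gf rat - a_circ_gf R rat].
Proof.
have tU A : 1 - t_gf A \is a GRing.unit by apply: fps_unit1B.
have b1u0 : bi_u0 (b1_gf R) = count_gf rat (pointed_forest_count 0).
  by rewrite b1_gfE.
split; last 1 first.
- apply: fpsP => N; rewrite coefsD coefsN a_gfE t_gfE mulrC -count_gfM /=.
  rewrite -forest_count1; case: eqP => [->|_].
    by rewrite forest_count_size0 subrr.
  have dimE : \dim (Omega R 1 0 N) = forest_count 1 N by apply: dim_Omega.
  by rewrite -dimE -dim_Psi natrD addrK.
- rewrite b0_gfE forest_series_exp a_gfE; congr (_ * fps_exp _).
  have -> // : tree_count = num_rooted_trees.
  by apply/funext => N; rewrite num_rooted_treesE.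
- rewrite b0_gfE b1_gfE; apply: pointed_series_solve; first exact: tU.
  by rewrite -pointed_tree_series; apply: pointed_forest_series.
- split.
    apply: fpsP => N; rewrite fpsXM b1u0 /=; case: N => [|N] //=.
    by rewrite dim_I1_rec.
  rewrite b1u0 -!mulrA; congr (_ * _).
  have X0 : count_gf rat (pointed_forest_count 0) =
      0 * (t_gf rat * a_gf R rat)
      + (t_gf rat / (1 - t_gf rat) * a_gf R rat
         + t_gf rat * count_gf rat (pointed_forest_count 0)).
    rewrite mul0r add0r -pointed_tree_series a_gfE.
    exact: pointed_forest_series0.
  by rewrite {1}(pointed_series_solve (tU rat) X0) addr0 mul0r subr0 mulr1.
Qed.
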